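(* Let $\mu\in M(\mathbb{R})$ and let $\widehat\mu$ be its Fourier transform. Then for every real $x$ the integral $\displaystyle\int_{-\infty}^\infty\frac{\widehat\mu(\lambda)}{\lambda-x}\,d\lambda$ exists, understood as $$\lim_{\varepsilon\to+0,\ N\to\infty}\left(\int_{-N}^{x-\varepsilon}\frac{\widehat\mu(\lambda)}{\lambda-x}\,d\lambda+\int_{x+\varepsilon}^{N}\frac{\widehat\mu(\lambda)}{\lambda-x}\,d\lambda\right),$$ and $$\frac1\pi\int_{-\infty}^\infty\frac{\widehat\mu(\lambda)}{\lambda-x}\,d\lambda=-i\,\widehat\nu(x),$$ where $\nu$ is the measure $d\nu(t)=(\operatorname{sign}t)\,d\mu(t)$.
   Context: $M(\mathbb{R})$ is the set of finite complex Borel measures on $\mathbb{R}$, and $\widehat\mu(x)=\frac{1}{\sqrt{2\pi}}\int_{-\infty}^{\infty}e^{-ixt}\,d\mu(t)$. Here $\operatorname{sign}0=0$. *)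

(* Defs.v *)
From HB Require Import structures.
From mathcomp Require Import all_boot all_order all_algebra.
From mathcomp Require Import complex.
From mathcomp Require Import ring lra.
From mathcomp Require Import all_classical all_reals all_analysis.
From mathcomp Require Import measurable_realfun.

Set Implicit Arguments.
Unset Strict Implicit.
Unset Printing Implicit Defensive.

Import Order.TTheory GRing.Theory Num.Theory.
Import numFieldNormedType.Exports.

Local Open Scope classical_set_scope.
Local Open Scope ring_scope.
Local Open Scope complex_scope.

(* The cast makes the topology of a numFieldType (here, that of the modulus)
   available on the complex numbers R[i]. *)
Notation Cplx R := (complex R : numFieldType).

Section complex_cvg.
Context {R : realType}.

Lemma complexP_lt (e : Cplx R) : 0 < e -> 0 < complex.Re e /\ e = (complex.Re e)%:C.
Proof.
case: e => a b; rewrite ltcE /= => /andP[/eqP -> a0]; split=> //.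
Qed.

Lemma normc_ltRI (z : R[i]) (e : R) :
  `|complex.Re z| < e / 2 -> `|complex.Im z| < e / 2 -> `|z| < e%:C.
Proof.
move=> h1 h2; rewrite normc_def ltcR.
have e0 : 0 < e / 2 by exact: le_lt_trans h1.
have {}e0 : 0 < e by rewrite -(@pmulr_lgt0 _ 2^-1) ?invr_gt0.
rewrite -[ltRHS]ger0_norm ?(ltW e0)// -sqrtr_sqr ltr_sqrt ?exprn_gt0//.
rewrite -(real_normK (num_real (complex.Re z))).
rewrite -(real_normK (num_real (complex.Im z))).
have q2 : (e / 2) ^+ 2 + (e / 2) ^+ 2 <= e ^+ 2.
  by have := sqr_ge0 e; nra.
apply: lt_le_trans q2.
by rewrite ltrD// ltr_pXn2r// nnegrE ?ltW// (le_lt_trans _ h1).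
Qed.


Lemma cvg_complexP (u : nat -> Cplx R) (l : Cplx R) :
  u n @[n --> \oo] --> l <->
  (complex.Re (u n) @[n --> \oo] --> complex.Re l) /\
  (complex.Im (u n) @[n --> \oo] --> complex.Im l).
Proof.
split=> [/cvgrPdist_lt ul|[/cvgrPdist_lt ur /cvgrPdist_lt ui]].
  split; apply/cvgrPdist_lt => e e0.
    have /ul : (0 : Cplx R) < e%:C by rewrite ltcR.
    apply: filterS => n; rewrite -ltcR => /(le_lt_trans _); apply.
    case: (l) (u n) => [a b] [c d] /=.
    rewrite normc_def/= lecR -sqrtr_sqr ler_wsqrtr// lerDl sqr_ge0//.
  have /ul : (0 : Cplx R) < e%:C by rewrite ltcR.
  apply: filterS => n; rewrite -ltcR => /(le_lt_trans _); apply.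
  case: (l) (u n) => [a b] [c d] /=.
  rewrite normc_def/= lecR -sqrtr_sqr ler_wsqrtr// lerDr sqr_ge0//.
apply/cvgrPdist_lt => e /complexP_lt[e0 ->].
have e20 : 0 < complex.Re e / 2 by rewrite divr_gt0.
move: (ur _ e20) (ui _ e20); apply: filterS2 => n.
by case: (l) (u n) => [a b] [c d] /= *; apply: normc_ltRI.
Qed.

End complex_cvg.

Lemma cvg_EFinP (K : numFieldType) (v : nat -> K) (l : K) :
  (v n)%:E @[n --> \oo] --> l%:E <-> v n @[n --> \oo] --> l.
Proof.
split=> vl A.
- move=> Al; have h : nbhs l (fun r => (EFin @` A) r%:E).
    by apply: filterS Al => r Ar; exists r.
  apply: (@filterS _ \oo _ (fun n => (EFin @` A) (v n)%:E)).
    by move=> n [r Ar [rv]] /=; rewrite -rv.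
  exact: (vl (EFin @` A) h).
- by move=> /= Al; exact: (vl (fun r => A r%:E)).
Qed.

(* A complex measure is a charge with values in \bar R[i]: the structure forces
   finite values on measurable sets and countable additivity for the topology
   of R[i]. Its real and imaginary parts are finite signed measures. *)
Section Re_Im_charge.
Context d (T : measurableType d) (R : realType).
Variable mu : {charge set T -> \bar R[i]}.

Definition Re_charge (A : set T) : \bar R := (complex.Re (fine (mu A)))%:E.
Definition Im_charge (A : set T) : \bar R := (complex.Im (fine (mu A)))%:E.

Let mu_cvg (F : (set T)^nat) : (forall i, measurable (F i)) ->
  trivIset setT F -> measurable (\bigcup_n F n) ->
  (\sum_(0 <= i < n) fine (mu (F i)) : Cplx R) @[n --> \oo] -->
  (fine (mu (\bigcup_n F n)) : Cplx R).
Proof.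
move=> mF tF mUF; apply/cvg_EFinP.
have := @charge_semi_sigma_additive _ _ _ mu F mF tF mUF.
rewrite fineK; last exact: fin_num_measure.
rewrite (_ : (fun n => (\sum_(0 <= i < n) mu (F i))%E) =
  fun n => (\sum_(0 <= i < n) fine (mu (F i)))%:E) //.
by apply/funext => n; rewrite -sumEFin; apply: eq_bigr => i _;
  rewrite fineK//; exact: fin_num_measure.
Qed.

Let Re_sum n (f : nat -> R[i]) :
  complex.Re (\sum_(0 <= i < n) f i) = \sum_(0 <= i < n) complex.Re (f i).
Proof.
elim: n => [|n IH]; first by rewrite !big_geq.
by rewrite !big_nat_recr//= -IH; case: (\sum_(_ <= _ < _) _) (f n) => ? ? [].
Qed.

Let Im_sum n (f : nat -> R[i]) :
  complex.Im (\sum_(0 <= i < n) f i) = \sum_(0 <= i < n) complex.Im (f i).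
Proof.
elim: n => [|n IH]; first by rewrite !big_geq.
by rewrite !big_nat_recr//= -IH; case: (\sum_(_ <= _ < _) _) (f n) => ? ? [].
Qed.

Let Re0 : Re_charge set0 = 0%E.
Proof. by rewrite /Re_charge charge0. Qed.

Let Im0 : Im_charge set0 = 0%E.
Proof. by rewrite /Im_charge charge0. Qed.

Let Re_semi_sigma_additive : semi_sigma_additive Re_charge.
Proof.
move=> F mF tF mUF; have /cvg_complexP[+ _] := mu_cvg mF tF mUF.
by under eq_cvg do rewrite Re_sum;
  move/cvg_EFinP; under eq_cvg do rewrite -sumEFin.
Qed.

Let Im_semi_sigma_additive : semi_sigma_additive Im_charge.
Proof.
move=> F mF tF mUF; have /cvg_complexP[_ +] := mu_cvg mF tF mUF.
by under eq_cvg do rewrite Im_sum;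
  move/cvg_EFinP; under eq_cvg do rewrite -sumEFin.
Qed.

HB.instance Definition _ := isCharge.Build _ _ _ Re_charge
  Re0 (fun _ _ => isT) Re_semi_sigma_additive.

HB.instance Definition _ := isCharge.Build _ _ _ Im_charge
  Im0 (fun _ _ => isT) Im_semi_sigma_additive.

End Re_Im_charge.

Section Jordan_parts.
Context d (T : measurableType d) (R : realType).
Variable nu : {charge set T -> \bar R}.

Definition Hahn_pos : set T := projT1 (cid (Hahn_decomposition nu)).
Definition Hahn_neg : set T :=
  projT1 (cid (projT2 (cid (Hahn_decomposition nu)))).
Definition Hahn_posneg : hahn_decomposition nu Hahn_pos Hahn_neg :=
  projT2 (cid (projT2 (cid (Hahn_decomposition nu)))).

(* The choice of the Hahn decomposition is immaterial: the Jordan parts do not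
   depend on it on measurable sets. *)
Definition charge_pos : {finite_measure set T -> \bar R} :=
  jordan_pos Hahn_posneg.
Definition charge_neg : {finite_measure set T -> \bar R} :=
  jordan_neg Hahn_posneg.

End Jordan_parts.

(* Complex integrands are integrated componentwise, and signed and complex
   measures through their Jordan, resp. real and imaginary, parts. *)
Section complex_integral.
Context d (T : measurableType d) (R : realType).
Implicit Types (D : set T) (f : T -> R[i]).

Definition complex_integrable (m : {measure set T -> \bar R}) D f : Prop :=
  m.-integrable D (fun t => (complex.Re (f t))%:E) /\
  m.-integrable D (fun t => (complex.Im (f t))%:E).

Definition complex_integral (m : {measure set T -> \bar R}) D f : R[i] :=
  (\int[m]_(t in D) complex.Re (f t)) +i* (\int[m]_(t in D) complex.Im (f t)).

Definition charge_integral (nu : {charge set T -> \bar R}) D f : R[i] :=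
  complex_integral (charge_pos nu) D f - complex_integral (charge_neg nu) D f.

Definition complex_charge_integral (mu : {charge set T -> \bar R[i]}) D f :
    R[i] :=
  charge_integral (Re_charge mu) D f + 'i%C * charge_integral (Im_charge mu) D f.

End complex_integral.

Section complex_charge_of_parts.
Context d (T : measurableType d) (R : realType).
Variables (c1 c2 : {charge set T -> \bar R}) (mu : set T -> \bar R[i]).
Hypothesis muE : forall A, measurable A ->
  mu A = (fine (c1 A) +i* fine (c2 A))%:E.

Lemma complex_charge_fin_num : fin_num_fun mu.
Proof. by move=> A mA; rewrite (muE mA) qualifE. Qed.

Let sumC n (f g : nat -> R) :
  (\sum_(0 <= i < n) (f i +i* g i)%:E)%E =
  ((\sum_(0 <= i < n) f i) +i* (\sum_(0 <= i < n) g i))%:E.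
Proof.
elim: n => [|n IH]; first by rewrite !big_geq.
by rewrite !big_nat_recr//= IH.
Qed.

Let sum_fine (c : {charge set T -> \bar R}) n (F : nat -> set T) :
  (forall i, measurable (F i)) ->
  \sum_(0 <= i < n) fine (c (F i)) = fine (\sum_(0 <= i < n) c (F i))%E.
Proof.
move=> mF; apply: EFin_inj; rewrite -sumEFin fineK; last first.
  by apply/sum_fin_numP => i _ _; exact: fin_num_measure.
by apply: eq_bigr => i _; rewrite fineK//; exact: fin_num_measure.
Qed.

Lemma complex_charge_semi_additive : measure_function.semi_additive mu.
Proof.
move=> F n mF tF mUF; rewrite muE//.
have := @charge_semi_additive _ _ _ c1 F n mF tF mUF.
have := @charge_semi_additive _ _ _ c2 F n mF tF mUF.
rewrite -!(big_mkord xpredT (fun i => _ (F i))) => -> ->.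
by rewrite -!sum_fine// -sumC; apply: eq_bigr => i _; rewrite muE.
Qed.

Lemma complex_charge_semi_sigma_additive : semi_sigma_additive mu.
Proof.
move=> F mF tF mUF; rewrite muE//.
rewrite (_ : (fun n => (\sum_(0 <= i < n) mu (F i))%E) = fun n =>
  ((\sum_(0 <= i < n) fine (c1 (F i))) +i*
   (\sum_(0 <= i < n) fine (c2 (F i))))%:E);
  last first.
  by apply/funext => n; rewrite -sumC; apply: eq_bigr => i _; rewrite muE.
have cvg_part (c : {charge set T -> \bar R}) :
    \sum_(0 <= i < n) fine (c (F i)) @[n --> \oo] --> fine (c (\bigcup_n F n)).
  apply/cvg_EFinP; rewrite fineK; last exact: fin_num_measure.
  rewrite (_ : (fun n => _) = fun n => (\sum_(0 <= i < n) c (F i))%E).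
    exact: charge_semi_sigma_additive.
  apply/funext => n; rewrite -sumEFin; apply: eq_bigr => i _.
  by rewrite fineK//; exact: fin_num_measure.
apply: (iffRL (@cvg_EFinP (Cplx R) _ _)); apply: (iffRL (cvg_complexP _ _)).
by split; exact: cvg_part.
Qed.

End complex_charge_of_parts.

Section sgn_charge.
Context (R : realType).
Variable mu : {charge set (measurableTypeR R) -> \bar R[i]}.

(* d nu = (sign t) d mu, i.e. nu A is the integral of sign over A against mu *)
Definition sgn_charge (A : set (measurableTypeR R)) : \bar R[i] :=
  (complex_charge_integral mu A (fun t : R => (Num.sg t)%:C))%:E.

Let measurable_sgr : measurable_fun [set: measurableTypeR R] (@Num.sg R).
Proof.
have -> : @Num.sg R = \1_(`]0, +oo[) \- \1_(`]-oo, 0[).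
  apply/funext => t; rewrite /= !indicE !mem_setE !in_itv/= andbT.
  by case: sgrP => t0; rewrite /= ?subrr ?subr0 ?sub0r.
apply: measurable_funB; exact: measurable_indic.
Qed.

Let integrable_sgr (m : {finite_measure set (measurableTypeR R) -> \bar R}) :
  m.-integrable setT (EFin \o (@Num.sg R)).
Proof.
apply: measurable_bounded_integrable => //.
- by rewrite ltey_eq fin_num_measure.
- by exists 1; split=> // M M1 t _ /=; rewrite (le_trans _ (ltW M1))// normr_sg lern1 leq_b1.
Qed.

Let sgn_part (nu : {charge set (measurableTypeR R) -> \bar R}) :
    {charge set (measurableTypeR R) -> \bar R} :=
  cadd (induced_charge (integrable_sgr (charge_pos nu)))
       (copp (induced_charge (integrable_sgr (charge_neg nu)))).

Let sgn_partE (nu : {charge set (measurableTypeR R) -> \bar R}) A : measurable A ->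
  charge_integral nu A (fun t : R => (Num.sg t)%:C) = (fine (sgn_part nu A))%:C.
Proof.
move=> mA; rewrite /charge_integral /complex_integral.
have I0 (m : {measure set (measurableTypeR R) -> \bar R}) :
    \int[m]_(t in A) complex.Im (Num.sg (t : R))%:C = 0.
  by rewrite /Rintegral integral0.
rewrite /sgn_part /cadd /copp /= fineD ?fineN; last 2 first.
- exact: fin_num_measure.
- by rewrite fin_numN; exact: fin_num_measure.
by rewrite !I0; congr (_ +i* _); rewrite subr0.
Qed.

Let sgn_chargeE A : measurable A ->
  sgn_charge A = (fine (sgn_part (Re_charge mu) A) +i*
                  fine (sgn_part (Im_charge mu) A))%:E.
Proof.
move=> mA; rewrite /sgn_charge /complex_charge_integral !sgn_partE//.
by congr EFin; rewrite [RHS]complexE.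
Qed.

HB.instance Definition _ := isFinite.Build _ _ _ sgn_charge
  (complex_charge_fin_num sgn_chargeE).
HB.instance Definition _ := isAdditiveCharge.Build _ _ _ sgn_charge
  (complex_charge_semi_additive sgn_chargeE).
HB.instance Definition _ := isSemiSigmaAdditive.Build _ _ _ sgn_charge
  (complex_charge_semi_sigma_additive sgn_chargeE).

End sgn_charge.

Section Fourier_pv.
Context (R : realType).

Definition expi (t : R) : R[i] := cos t +i* sin t.

Definition Fourier (mu : {charge set (measurableTypeR R) -> \bar R[i]}) (x : R) :
    R[i] :=
  ((Num.sqrt (2 * pi))^-1)%:C *
  complex_charge_integral mu setT (fun t : R => expi (- (x * t))).

Definition Cauchy_integrand (f : R -> R[i]) (x l : R) : R[i] :=
  f l / (l - x)%:C.

Definition pv_trunc (f : R -> R[i]) (x : R) (eN : R * R) : Cplx R :=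
  complex_integral lebesgue_measure `[- eN.2, x - eN.1]
    (Cauchy_integrand f x) +
  complex_integral lebesgue_measure `[x + eN.1, eN.2]
    (Cauchy_integrand f x).

(* pairs (eps, N) with jointly eps --> 0+ and N --> +oo *)
Definition pv_filter : set_system (R * R) := filter_prod 0^'+ +oo.

(* The integrability clauses exclude the default value given by the library to
   the integral of a non-integrable function. *)
Definition pv_exists (f : R -> R[i]) (x : R) : Prop :=
  (forall e N : R, 0 < e ->
     complex_integrable lebesgue_measure `[- N, x - e] (Cauchy_integrand f x) /\
     complex_integrable lebesgue_measure `[x + e, N] (Cauchy_integrand f x)) /\
  cvg (pv_trunc f x @ pv_filter).

Definition pv_integral (f : R -> R[i]) (x : R) : R[i] :=
  lim (pv_trunc f x @ pv_filter).

End Fourier_pv.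

(* Main.v *)
Require Import Defs.
From HB Require Import structures.
From mathcomp Require Import all_boot all_order all_algebra.
From mathcomp Require Import complex.
From mathcomp Require Import ring lra.
From mathcomp Require Import all_classical all_reals all_analysis.
From mathcomp Require Import measurable_realfun.

(* By linearity it is enough to treat one of the four Jordan parts m of mu. By
   Fubini, the truncated integral of the Fourier transform of m is the integral
   against m of the truncated integral of exp(-i l t) / (l - x) over l. Writing
   l = x + s, the cosines in s cancel up to a boundary term O(x / N), and twice
   the sine integral remains, which is bounded and tends to (pi / 2) sign t for
   each t; dominated convergence concludes. The Dirichlet integral itself comes
   from 1 / s = t * int_0^oo exp(-s t y) dy and Fubini. *)

Set Implicit Arguments.
Unset Strict Implicit.
Unset Printing Implicit Defensive.

Import Order.TTheory GRing.Theory Num.Theory.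
Import numFieldNormedType.Exports.

Local Open Scope classical_set_scope.
Local Open Scope ring_scope.
Local Open Scope complex_scope.

(** The convergence in t is not uniform: for small [|t|] the tail beyond N decays slowly, and for
    large [|t|] the part of the sine integral cut off near 0 is not yet small. So the error of the
    truncated kernel is kept as an explicit function of t, bounded for all t and small for each t,
    and is then averaged against m. The kernel exp(-i l t) is expanded about x by the addition
    formulas. Only its component odd in l - x survives, and this turns cos into - sin and sin into
    cos at x t; that rotation is the factor -i of the statement. A last obstacle lies on the
    right-hand side. The Fourier transform of nu integrates against the Jordan parts of the real and
    imaginary parts of nu, which come from Hahn decompositions of their own, chosen independently of
    those of mu. That integrating against nu amounts to integrating sign times the integrand against
    mu therefore needs a separate argument. *)

Local Notation leb := lebesgue_measure.

(** * Fubini on a product of two measurable sets *)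

Section fubini_rectangle.
Context d1 d2 (T1 : measurableType d1) (T2 : measurableType d2) (R : realType).
Variables (m1 : {sigma_finite_measure set T1 -> \bar R})
  (m2 : {sigma_finite_measure set T2 -> \bar R}).
Variables (D1 : set T1) (D2 : set T2) (f : T1 -> T2 -> \bar R).
Hypotheses (mD1 : measurable D1) (mD2 : measurable D2).
Hypothesis mf : measurable_fun setT (fun z : T1 * T2 => f z.1 z.2).
Hypothesis f_lty :
  (\int[m1]_(x in D1) \int[m2]_(y in D2) `|f x y| < +oo)%E.

(** Extension by zero reduces the rectangle to the full product space. *)
Let g := (fun z : T1 * T2 => f z.1 z.2) \_ (D1 `*` D2).

Let gE x y : g (x, y) = ((fun x => (f x \_ D2) y) \_ D1) x.
Proof. by rewrite /g !patchE in_setX; case: (x \in D1). Qed.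

(** [h] is [abse] for integrability and [id] for the iterated integral; it must fix 0 because [g]
    vanishes off the rectangle. *)
Let g1 (h : \bar R -> \bar R) : h 0%E = 0%E -> forall x,
  (\int[m2]_y h (g (x, y)) = ((fun x => \int[m2]_(y in D2) h (f x y)) \_ D1) x)%E.
Proof.
move=> h0 x; rewrite patchE; case: ifPn => xD.
  rewrite [RHS]integral_mkcond; apply: eq_integral => y _.
  by rewrite gE patchE xD !patchE; case: ifP.
by rewrite integral0_eq// => y _; rewrite gE patchE (negbTE xD).
Qed.

Let g2 y : (\int[m1]_x g (x, y) = ((fun y => \int[m1]_(x in D1) f x y) \_ D2) y)%E.
Proof.
rewrite patchE; case: ifPn => yD.
  rewrite [RHS]integral_mkcond; apply: eq_integral => x _.
  by rewrite gE !patchE yD.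
by rewrite integral0_eq// => x _; rewrite gE !patchE (negbTE yD) if_same.
Qed.

Let mg : measurable_fun setT g.
Proof.
apply/(measurable_restrictT _ _).1; first exact: measurableX.
exact: measurable_funTS.
Qed.

Let ig : (m1 \x m2)%E.-integrable setT g.
Proof.
apply/integrable12ltyP => //.
under eq_integral do rewrite (g1 (@abse0 R)).
by rewrite -integral_mkcond.
Qed.

Lemma integrable_fubini_rectangle :
  m1.-integrable D1 (fun x => \int[m2]_(y in D2) f x y)%E.
Proof.
rewrite -[D1]setTI; apply/(integrable_restrict m1 mD1 measurableT).
have -> : ((fun x => \int[m2]_(y in D2) f x y) \_ D1 =
    (fun x => \int[m2]_y g (x, y)))%E by apply/funext => x; rewrite (@g1 id erefl).
exact: integrable_fubini_F ig.
Qed.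

Lemma measurable_fubini_rectangle2 :
  measurable_fun D2 (fun y => \int[m1]_(x in D1) f x y)%E.
Proof.
apply/(measurable_restrictT _ mD2).
have -> : ((fun y => \int[m1]_(x in D1) f x y) \_ D2 =
    (fun y => \int[m1]_x g (x, y)))%E by apply/funext => y; rewrite g2.
exact: measurable_fubini_G ig.
Qed.

Lemma fubini_rectangle :
  (\int[m1]_(x in D1) \int[m2]_(y in D2) f x y =
   \int[m2]_(y in D2) \int[m1]_(x in D1) f x y)%E.
Proof.
rewrite [LHS]integral_mkcond [RHS]integral_mkcond.
have -> : ((fun x => \int[m2]_(y in D2) f x y) \_ D1 =
    (fun x => \int[m2]_y g (x, y)))%E by apply/funext => x; rewrite (@g1 id erefl).
by rewrite (Fubini ig); apply: eq_integral => y _; rewrite g2.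
Qed.

End fubini_rectangle.

(** * The Dirichlet integral with an explicit rate *)

Section sine_integral.
Context (R : realType).

Lemma is_derive_continuous (F : R -> R) (x df : R) :
  is_derive x 1 F df -> {for x, continuous F}.
Proof.
by move=> dF; apply/differentiable_continuous/derivable1_diffP.
Qed.

Lemma FTC2_is_derive (f F : R -> R) a b : a <= b ->
  (forall s : R, is_derive s 1 F (f s)) -> continuous f ->
  \int[leb]_(s in `[a, b]) f s = F b - F a.
Proof.
rewrite le_eqVlt => /predU1P[->|ab] dF cf.
  by rewrite set_itv1 Rintegral_set1 subrr.
rewrite /Rintegral (@continuous_FTC2 _ f F)//.
- exact: continuous_subspaceT.
- split.
  + by move=> x _; exact: ex_derive.
  + exact/cvg_at_right_filter/is_derive_continuous.
  + exact/cvg_at_left_filter/is_derive_continuous.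
- by move=> x _; rewrite derive1E; exact: derive_val.
Qed.

Lemma ler_norm_sin (x : R) : `|sin x| <= `|x|.
Proof.
wlog x0 : x / 0 <= x => [h|].
  by have [/h//|/ltW x0] := leP 0 x; rewrite -normrN -sinN -(normrN x) h// oppr_ge0.
rewrite (ger0_norm x0).
have [c _ ] := @MVT_segment R sin cos 0 x x0 (fun y _ => is_derive_sin y)
  (continuous_subspaceT (@continuous_sin R)).
rewrite sin0 !subr0 => ->.
by rewrite normrM (ger0_norm x0) ler_piMl// cos_max.
Qed.

(** The factor r normalises the integral to 1. It is used with r = s t for the damping factor and
    with r = A t for the remainder. *)
Lemma integral_expRN (r : R) : 0 < r ->
  (\int[leb]_(y in `[0%R, +oo[) (r * expR (- (r * y)))%:E = 1)%E.
Proof.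
move=> r0.
have dF (y : R) : is_derive y 1 (fun y : R => - expR (- (r * y)))
    (r * expR (- (r * y))).
  apply: is_derive_eq.
  rewrite /GRing.scale/= !mulr1; ring.
rewrite (@ge0_continuous_FTC2y _ _ (fun y : R => - expR (- (r * y))) 0 0).
- by rewrite mulr0 oppr0 expR0 EFinN oppeK add0e.
- by move=> x _; rewrite mulr_ge0 ?expR_ge0// ltW.
- apply: continuous_subspaceT => y; apply: cvgM; first exact: cvg_cst.
  apply: (@continuous_comp _ _ _ (fun y : R => - (r * y)) expR); last exact: continuous_expR.
  by apply: cvgN; apply: cvgM; [exact: cvg_cst|exact: cvg_id].
- rewrite -oppr0; apply: cvgN.
  apply: (cvg_comp (fun y => r * y) (fun y => expR (- y))); last exact: cvgr_expR.
  exact: gt0_cvgMry.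
- by move=> x _; exact: ex_derive.
- exact/cvg_at_right_filter/is_derive_continuous.
- by move=> x _; rewrite derive1E; exact: derive_val.
Qed.

Lemma ge0_integrable_fin d (T : measurableType d) (m : {measure set T -> \bar R})
    (D : set T) (f : T -> R) (r : R) : measurable D -> measurable_fun D f ->
  (forall x, D x -> 0 <= f x) -> (\int[m]_(x in D) (f x)%:E = r%:E)%E ->
  m.-integrable D (EFin \o f).
Proof.
move=> mD mf f0 fr; apply/integrableP; split; first exact/measurable_EFinP.
rewrite (eq_integral (EFin \o f)) ?fr ?ltry// => x /[!inE] Dx /=.
by rewrite ger0_norm// f0.
Qed.

Lemma measurable_expRN (r : R) :
  measurable_fun setT (fun y : R => r * expR (- (r * y))).
Proof.
apply: measurable_funM => //; apply: measurableT_comp => //.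
by apply: measurableT_comp => //; exact: measurable_funM.
Qed.

Lemma integrable_expRN (r : R) : 0 < r ->
  leb.-integrable `[0, +oo[ (EFin \o (fun y : R => r * expR (- (r * y)))).
Proof.
move=> r0; apply: ge0_integrable_fin (integral_expRN r0) => //.
- by apply: measurable_funTS; exact: measurable_expRN.
- by move=> y _; rewrite mulr_ge0 ?expR_ge0// ltW.
Qed.

Lemma integrable_oneDsqrV :
  leb.-integrable `[0, +oo[ (EFin \o (fun y : R => (1 + y ^+ 2)^-1)).
Proof.
apply: ge0_integrable_fin (@integral0y_oneDsqr R) => //.
by apply: measurable_funTS; apply: continuous_measurable_fun; exact: continuous_oneDsqrV.
Qed.

(** Inversion is continuous only off 0, but the convention [0^-1 = 0] makes it equal to its
    restriction to the complement of 0 extended by zero. *)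
Lemma measurable_inv : measurable_fun setT (fun x : R => x^-1).
Proof.
have oD : open (~` [set 0 : R]) by apply: closed_openC; exact: closed_eq.
have mD : measurable (~` [set 0 : R]) by exact: open_measurable.
have -> : (fun x : R => x^-1) = (fun x : R => x^-1) \_ (~` [set 0 : R]).
  apply/funext => x; rewrite patchE; case: ifPn => //.
  by rewrite notin_setE /= => /contrapT ->; rewrite invr0.
have cV : {in ~` [set 0 : R], continuous (fun x : R => x^-1)}.
  by move=> x; rewrite inE => /eqP x0; apply: cvgV => //; exact: cvg_id.
apply: (measurable_restrictT _ mD).1.
exact: (open_continuous_measurable_fun oD cV).
Qed.

(** Without division by s the integrand is smooth in s up to 0, as the primitive in s requires;
    [dampedE] gives the form suited to integration in y. *)
Let damped (t s y : R) : R := t * sin (s * t) * expR (- (s * t * y)).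

Let dampedE (t s y : R) : 0 < s ->
  damped t s y = sin (s * t) / s * (s * t * expR (- (s * t * y))).
Proof. by move=> s0; rewrite /damped; field; rewrite gt_eqF. Qed.

Let integral_damped_y (t s : R) : 0 < t -> 0 < s ->
  (\int[leb]_(y in `[0%R, +oo[) (damped t s y)%:E = (sin (s * t) / s)%:E)%E.
Proof.
move=> t0 s0; under eq_integral do rewrite dampedE// EFinM.
have st0 : 0 < s * t by exact: mulr_gt0.
rewrite integralZl//; last exact: integrable_expRN.
by rewrite integral_expRN// mule1.
Qed.

Let integral_abs_damped_y (t s : R) : 0 < t -> 0 < s ->
  (\int[leb]_(y in `[0%R, +oo[) `|(damped t s y)%:E| = (`|sin (s * t) / s|)%:E)%E.
Proof.
move=> t0 s0.
have st0 : 0 < s * t by exact: mulr_gt0.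
transitivity (\int[leb]_(y in `[0%R, +oo[)
   ((`|sin (s * t) / s|)%:E * (s * t * expR (- (s * t * y)))%:E))%E.
  apply: eq_integral => y _; rewrite dampedE// -EFinM /= normrM; congr (_ * _)%:E.
  by rewrite ger0_norm// mulr_ge0 ?expR_ge0// ltW.
rewrite integralZl//; last exact: integrable_expRN.
by rewrite integral_expRN// mule1.
Qed.

Lemma normr_sinV_le (s t : R) : `|sin (s * t) / s| <= `|t|.
Proof.
have [->|s0] := eqVneq s 0; first by rewrite invr0 mulr0 normr0.
rewrite normrM normfV ler_pdivrMr ?normr_gt0// mulrC -normrM.
exact: ler_norm_sin.
Qed.

Let measurable_damped (t : R) : measurable_fun setT
  (fun z : measurableTypeR R * measurableTypeR R => (damped t z.1 z.2)%:E).
Proof.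
apply/measurable_EFinP.
have ms : measurable_fun setT
    (fun z : measurableTypeR R * measurableTypeR R => z.1 * t).
  exact: measurable_funM.
apply: measurable_funM.
  apply: measurable_funM => //.
  by apply: (measurableT_comp _ ms); apply: continuous_measurable_fun; exact: continuous_sin.
apply: measurableT_comp => //; apply: measurableT_comp => //.
exact: measurable_funM.
Qed.

Let integral_damped_s (t A y : R) : 0 < A ->
  (\int[leb]_(s in `]0%R, A]) (damped t s y)%:E =
  ((1 + y ^+ 2)^-1 -
    expR (- (A * t * y)) * (cos (A * t) + y * sin (A * t)) / (1 + y ^+ 2))%:E)%E.
Proof.
move=> A0.
have cdamped : continuous (fun s => damped t s y).
  by move=> s; apply/differentiable_continuous/derivable1_diffP/ex_derive.
have mdamped : measurable_fun setT (fun s => damped t s y).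
  exact: continuous_measurable_fun.
have y0 : 1 + y ^+ 2 != 0 by rewrite gt_eqF// ltr_pwDl ?sqr_ge0.
(* In the variable u = s t, which absorbs the factor t, this is the primitive of exp(-u y) sin u
   obtained by integrating by parts twice. *)
pose F (s : R) := - expR (- (s * t * y)) * (cos (s * t) + y * sin (s * t)) / (1 + y ^+ 2).
have dF (s : R) : is_derive s 1 F (damped t s y).
  by apply: is_derive_eq; rewrite /damped /GRing.scale/=; field.
rewrite integral_itv_obnd_cbnd; last by apply/measurable_EFinP; exact: measurable_funTS.
rewrite -[LHS]fineK; last first.
  apply: integrable_fin_num => //=.
  apply: continuous_compact_integrable; first exact: segment_compact.
  exact: continuous_subspaceT.
rewrite -[fine _]/(\int[leb]_(s in `[0%R, A]) damped t s y) (FTC2_is_derive (ltW A0) dF)//.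
congr EFin; rewrite /F !mul0r oppr0 expR0 cos0 sin0 mulr0 addr0; ring.
Qed.

(** After the exchange the integrand in y is 1 / (1 + y^2) minus a remainder. The first term
    integrates to pi / 2; the remainder is at most 2 exp(-A t y) in modulus, whose integral is the
    stated error. *)
Lemma sine_integral_bound (t A : R) : 0 < t -> 0 < A ->
  `|\int[leb]_(s in `]0, A]) (sin (s * t) / s) - pi / 2| <= 2 / (A * t).
Proof.
move=> t0 A0; have At0 : 0 < A * t by exact: mulr_gt0.
have mD1 : measurable (`]0, A]%classic : set (measurableTypeR R)) by [].
have mD2 : measurable (`[0, +oo[%classic : set (measurableTypeR R)) by [].
have sA s : s \in (`]0, A]%classic : set R) -> 0 < s.
  by rewrite inE/= in_itv/= => /andP[].
(* Fubini is licensed by the truncation at A: the absolute inner integral is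
   [|sin (s * t) / s| <= t] on an interval of finite length. *)
have damped_lty : (\int[leb]_(s in `]0%R, A]) \int[leb]_(y in `[0%R, +oo[)
    `|(damped t s y)%:E| < +oo)%E.
  apply: (@le_lt_trans _ _ (\int[leb]_(s in `]0%R, A]) t%:E)%E).
    apply: ge0_le_integral => //.
    - by move=> s _; exact: integral_ge0.
    - pose h (s : R) := (`|sin (s * t) / s|)%:E.
      apply: (eq_measurable_fun h).
        by move=> s /sA s0; rewrite integral_abs_damped_y.
      apply/measurable_EFinP; apply: measurable_funTS; apply: measurableT_comp => //.
      apply: measurable_funM; last exact: measurable_inv.
      apply: continuous_measurable_fun => s.
      exact/differentiable_continuous/derivable1_diffP/ex_derive.
    - move=> s sA'; rewrite integral_abs_damped_y//; last by apply: sA; rewrite inE.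
      by rewrite lee_fin (le_trans (normr_sinV_le _ _))// gtr0_norm.
  by rewrite integral_cst//= lebesgue_measure_itv/= lte_fin A0 -EFinB -EFinM ltry.
pose g (y : R) := expR (- (A * t * y)) * (cos (A * t) + y * sin (A * t)) / (1 + y ^+ 2).
have mg : measurable_fun setT g.
  apply: measurable_funM; last first.
    by apply: continuous_measurable_fun; exact: continuous_oneDsqrV.
  apply: continuous_measurable_fun => y.
  exact/differentiable_continuous/derivable1_diffP/ex_derive.
(* The constant 2 comes from 1 + y <= 2 (1 + y^2); the factor A t is inserted to match
   [integral_expRN]. *)
have gE (y : R) : 0 <= y -> `|g y| <= 2 / (A * t) * (A * t * expR (- (A * t * y))).
  move=> y0; have e0 := expR_gt0 (- (A * t * y)).
  have -> : 2 / (A * t) * (A * t * expR (- (A * t * y))) = expR (- (A * t * y)) * 2.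
    by field; rewrite !gt_eqF.
  rewrite /g !normrM -mulrA (gtr0_norm e0) ler_pM2l//.
  have y1 : 0 < 1 + y ^+ 2 by rewrite ltr_pwDl ?sqr_ge0.
  rewrite normfV (gtr0_norm y1) ler_pdivrMr//.
  apply: (@le_trans _ _ (1 + y)); last by have := sqr_ge0 (y - 1); nra.
  rewrite (le_trans (ler_normD _ _))// lerD ?cos_max//.
  by rewrite normrM (ger0_norm y0) ler_piMr// sin_max.
have ibound : leb.-integrable `[0, +oo[
    (EFin \o (fun y : R => 2 / (A * t) * (A * t * expR (- (A * t * y))))).
  by apply: (fun m => integrableZl m (2 / (A * t)) (integrable_expRN At0)).
have ig : leb.-integrable `[0, +oo[ (EFin \o g).
  apply: le_integrable ibound => //; first by apply/measurable_EFinP; exact: measurable_funTS.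
  move=> y /=; rewrite in_itv/= andbT => y0; rewrite lee_fin.
  by apply: le_trans (gE _ y0) _; rewrite ler_norm.
have -> : \int[leb]_(s in `]0, A]) (sin (s * t) / s) =
    pi / 2 - \int[leb]_(y in `[0, +oo[) g y.
  transitivity (fine (\int[leb]_(s in `]0%R, A]) \int[leb]_(y in `[0%R, +oo[)
    (damped t s y)%:E))%E.
    by congr fine; apply: eq_integral => s /sA s0; rewrite integral_damped_y.
  rewrite (fubini_rectangle (m1 := leb) (m2 := leb)
    (f := fun s y => (damped t s y)%:E) mD1 mD2 (measurable_damped t) damped_lty).
  under eq_integral do rewrite integral_damped_s//.
  rewrite -/(\int[leb]_(y in `[0, +oo[) ((1 + y ^+ 2)^-1 - g y)).
  rewrite (RintegralB _ integrable_oneDsqrV ig)//; congr (_ - _).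
  by rewrite /Rintegral integral0y_oneDsqr.
rewrite addrAC subrr add0r normrN.
apply: le_trans; first exact: (le_normr_Rintegral _ ig).
apply: (@le_trans _ _ (\int[leb]_(y in `[0, +oo[)
   (2 / (A * t) * (A * t * expR (- (A * t * y)))))).
  apply: le_Rintegral => //; first by exact: integrable_norm ig.
  by move=> y /=; rewrite in_itv/= andbT => /gE.
rewrite RintegralZl//; last exact: integrable_expRN.
by rewrite /Rintegral integral_expRN// mulr1.
Qed.

End sine_integral.

(** * The truncated Cauchy kernel in terms of sine and cosine integrals *)

Section truncated_kernel.
Context (R : realType).
Implicit Types s t x a b e N : R.

Lemma Rintegral_itv_translate (G : R -> R) x a b : a <= b ->
  {within `[a + x, b + x], continuous G} ->
  \int[leb]_(l in `[a + x, b + x]) G l = \int[leb]_(s in `[a, b]) G (s + x).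
Proof.
move=> ab cG.
have dS : derive1 (fun s => s + x) = cst 1.
  by apply/funext => s; rewrite derive1E derive_val addr0.
rewrite /Rintegral (@integration_by_substitution_increasing _ (fun s => s + x) G)//.
- by congr fine; apply: eq_integral => s _ /=; rewrite !fctE dS mulr1.
- by move=> s s' _ _ ss'; rewrite ltrD2r.
- by rewrite dS => s _; exact: cvg_cst.
- by rewrite dS; exact: is_cvg_cst.
- by rewrite dS; exact: is_cvg_cst.
- split.
  + by move=> s _; exact: ex_derive.
  + by apply: cvg_at_right_filter; apply: cvgD; [exact: cvg_id|exact: cvg_cst].
  + by apply: cvg_at_left_filter; apply: cvgD; [exact: cvg_id|exact: cvg_cst].
Qed.

Lemma Rintegral_itv_oppr (G : R -> R) a b : a <= b ->
  {within `[- b, - a], continuous G} ->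
  \int[leb]_(s in `[- b, - a]) G s = \int[leb]_(s in `[a, b]) G (- s).
Proof. by move=> ab cG; rewrite /Rintegral integration_by_substitution_oppr. Qed.

Lemma continuous_divB (f : R -> R) x l : continuous f -> l != x ->
  {for l, continuous (fun l => f l / (l - x))}.
Proof.
move=> cf lx; apply: cvgM; first exact: cf.
apply: cvgV; first by rewrite subr_eq0.
by apply: cvgB; [exact: cvg_id|exact: cvg_cst].
Qed.

Lemma within_continuous_divB (f : R -> R) x a b : continuous f ->
  (b < x) || (x < a) -> {within `[a, b], continuous (fun l => f l / (l - x))}.
Proof.
move=> cf abx; apply: continuous_in_subspaceT => l.
rewrite inE/= in_itv/= => /andP[al lb]; apply: continuous_divB => //.
case/orP: abx => h; first by rewrite lt_eqF// (le_lt_trans lb).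
by rewrite gt_eqF// (lt_le_trans h).
Qed.

Lemma integrable_divB (f : R -> R) x a b : continuous f ->
  (b < x) || (x < a) -> leb.-integrable `[a, b] (EFin \o (fun l => f l / (l - x))).
Proof.
move=> cf abx; apply: continuous_compact_integrable; first exact: segment_compact.
exact: within_continuous_divB.
Qed.

Lemma integrable_divr (f : R -> R) a b : continuous f -> 0 < a ->
  leb.-integrable `[a, b] (EFin \o (fun s => f s / s)).
Proof.
move=> cf a0; rewrite (_ : (fun s => f s / s) = (fun s => f s / (s - 0))).
  by apply: integrable_divB; rewrite // a0 orbT.
by apply/funext => s; rewrite subr0.
Qed.

Lemma continuous_cosM t : continuous (fun s : R => cos (s * t)).
Proof. by move=> s; apply/differentiable_continuous/derivable1_diffP/ex_derive. Qed.

Lemma continuous_sinM t : continuous (fun s : R => sin (s * t)).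
Proof. by move=> s; apply/differentiable_continuous/derivable1_diffP/ex_derive. Qed.

(** The cosine integral diverges logarithmically as its lower end tends to 0, so only differences
    with a common lower end are estimated. *)
Definition cos_integral t a b := \int[leb]_(s in `[a, b]) (cos (s * t) / s).
Definition sin_integral t a b := \int[leb]_(s in `[a, b]) (sin (s * t) / s).

(* The odd part of the Cauchy kernel keeps the sine, while the cosines cancel
   up to the asymmetry of [-N, N] around x. *)
Lemma pv_kernelE (p q : R) t x e N : 0 < e -> e <= N - x -> e <= N + x ->
  let phi (l : R) := p * cos ((l - x) * t) + q * sin ((l - x) * t) in
  \int[leb]_(l in `[- N, x - e]) (phi l / (l - x)) +
  \int[leb]_(l in `[x + e, N]) (phi l / (l - x)) =
  p * (cos_integral t e (N - x) - cos_integral t e (N + x)) +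
  q * (sin_integral t e (N - x) + sin_integral t e (N + x)).
Proof.
move=> e0 eNx eNx' phi.
have cphi : continuous phi.
  by move=> s; apply/differentiable_continuous/derivable1_diffP/ex_derive.
pose psi (s : R) := p * cos (s * t) + q * sin (s * t).
have cpsi : continuous psi.
  by move=> s; apply/differentiable_continuous/derivable1_diffP/ex_derive.
have xe : x - e < x by rewrite ltrBlDr ltrDl.
(* [c] is [q] to the right of x and [- q] to the left, where s is reflected. *)
have lin (c : R) b : \int[leb]_(s in `[e, b]) ((p * cos (s * t) + c * sin (s * t)) / s) =
    p * cos_integral t e b + c * sin_integral t e b.
  have ic := @integrable_divr _ e b (@continuous_cosM t) e0.
  have is_ := @integrable_divr _ e b (@continuous_sinM t) e0.
  transitivity (\int[leb]_(s in `[e, b]) (p * (cos (s * t) / s) + c * (sin (s * t) / s))).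
    by apply: eq_Rintegral => s _; rewrite mulrDl !mulrA.
  rewrite RintegralD//=; first by rewrite !RintegralZl.
  - by apply: (fun m => integrableZl m p ic).
  - by apply: (fun m => integrableZl m c is_).
have -> : \int[leb]_(l in `[x + e, N]) (phi l / (l - x)) =
    p * cos_integral t e (N - x) + q * sin_integral t e (N - x).
  have := @Rintegral_itv_translate (fun l => phi l / (l - x)) x e (N - x) eNx.
  rewrite (addrC e) subrK => -> //.
    rewrite -lin; apply: eq_Rintegral => s _.
    by rewrite /phi addrK.
  by apply: within_continuous_divB => //; rewrite ltrDl e0 orbT.
have -> : \int[leb]_(l in `[- N, x - e]) (phi l / (l - x)) =
    - (p * cos_integral t e (N + x) - q * sin_integral t e (N + x)).
  have := @Rintegral_itv_translate (fun l => phi l / (l - x)) x (- (N + x)) (- e).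
  rewrite lerN2 => /(_ eNx'); rewrite opprD subrK -opprD (addrC (- e)) => ->; last first.
    by apply: within_continuous_divB => //; rewrite xe.
  rewrite (_ : \int[leb]_(s in _) _ = \int[leb]_(s in `[- (N + x), - e]) (psi s / (s - 0))).
    rewrite Rintegral_itv_oppr//; last first.
      by apply: within_continuous_divB; rewrite // oppr_lt0 e0.
    rewrite -mulNr -lin -[RHS]mulN1r -RintegralZl//; last first.
      apply: (@integrable_divr (fun s => p * cos (s * t) + - q * sin (s * t))) => // s.
      exact/differentiable_continuous/derivable1_diffP/ex_derive.
    apply: eq_Rintegral => s _; rewrite /psi subr0 mulNr cosN sinN invrN; ring.
  by apply: eq_Rintegral => s _; rewrite /phi /psi addrK subr0.
ring.
Qed.

End truncated_kernel.

(** * Error bounds for the truncated sine and cosine integrals *)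

Section sine_cosine_integral_bounds.
Context (R : realType).
Implicit Types s t x a b e N A : R.

Let integrable_sinc t a : leb.-integrable `]0, a] (EFin \o (fun s => sin (s * t) / s)).
Proof.
apply: measurable_bounded_integrable => //=.
- rewrite lebesgue_measure_itv/=; case: ifPn => // _.
  by rewrite -EFinB ltry.
- apply: measurable_funTS; apply: measurable_funM; last exact: measurable_inv.
  by apply: continuous_measurable_fun; exact: continuous_sinM.
- exists `|t|; split=> // M tM s _ /=.
  exact: le_trans (normr_sinV_le _ _) (ltW tM).
Qed.

(** Covers small a t, where the bound 2 / (a t) of [sine_integral_bound] blows up. *)
Let sine_integral_small t a : 0 <= a ->
  `|\int[leb]_(s in `]0, a]) (sin (s * t) / s)| <= a * `|t|.
Proof.
move=> a0; apply: le_trans; first by apply: le_normr_Rintegral => //; exact: integrable_sinc.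
have it : leb.-integrable `]0, a] (EFin \o (fun _ : R => `|t|)).
  apply: measurable_bounded_integrable => //=.
  - rewrite lebesgue_measure_itv/=; case: ifPn => // _.
    by rewrite -EFinB ltry.
  - by exists `|t|; split=> // M tM s _ /=; rewrite normr_id ltW.
apply: le_trans.
  apply: (le_Rintegral _ _ it) => //.
    exact: integrable_norm (integrable_sinc t a).
  by move=> s _; exact: normr_sinV_le.
rewrite Rintegral_cst//= lebesgue_measure_itv/= lte_fin mulrC.
case: ifPn => [_|_ /=]; last by rewrite mul0r mulr_ge0.
by rewrite -EFinB subr0.
Qed.

Let sin_integralE t e A : 0 < e -> e <= A -> sin_integral t e A =
  \int[leb]_(s in `]0, A]) (sin (s * t) / s) -
  \int[leb]_(s in `]0, e]) (sin (s * t) / s).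
Proof.
move=> e0 eA; rewrite Rintegral_itvB//; last by rewrite bnd_simp ltW.
rewrite /sin_integral Rintegral_itv_obnd_cbnd//.
apply: integrableS (integrable_sinc t A) => //.
by apply: subset_itvr; rewrite bnd_simp ltW.
Qed.

(** For positive t and a the integral over []0, a]] lies within pi / 2 + 2 of pi / 2, hence is at
    most pi + 2 in modulus. *)
Definition sine_bound : R := pi + 2.

(* Division by zero gives 0 at t = 0, where the sine integral vanishes. *)
Definition sine_error (r : R) t : R :=
  Order.min sine_bound (`|t| / r) + Order.min sine_bound (2 / (r * `|t|)).

Lemma sine_bound_gt0 : 0 < sine_bound.
Proof. by rewrite addr_gt0// pi_gt0. Qed.

Lemma sin_integralN t e A : 0 < e ->
  sin_integral (- t) e A = - sin_integral t e A.
Proof.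
move=> e0; rewrite /sin_integral -[RHS]mulN1r -RintegralZl//; last first.
  exact: (integrable_divr _ (@continuous_sinM R t) e0).
by apply: eq_Rintegral => s _; rewrite mulrN sinN; ring.
Qed.

(** Each term of [sine_error] belongs to one end of the range: [|t| / r] bounds the missing integral
    over []0, e]], and [2 / (r * |t|)] the distance of the integral over []0, A]] to its limit. Both
    integrals are odd in t, so t > 0 is the essential case. *)
Lemma sin_integral_error (r : R) t e A : 0 < r -> 0 < e -> e <= r^-1 -> r <= A -> e <= A ->
  `|sin_integral t e A - pi / 2 * Num.sg t| <= sine_error r t.
Proof.
move=> r0 e0 er rA eA; have A0 : 0 < A by exact: lt_le_trans rA.
have p0 := @pi_gt0 R.
wlog t0 : t / 0 <= t => [h|].
  have [/h//|/ltW t0] := leP 0 t.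
  have := h (- t); rewrite oppr_ge0 => /(_ t0).
  by rewrite sin_integralN// sgrN mulrN -opprD normrN /sine_error normrN.
move: t0; rewrite le_eqVlt => /predU1P[<-|t0].
  rewrite /sin_integral /sine_error.
  under eq_Rintegral do rewrite mulr0 sin0 mul0r.
  rewrite Rintegral_cst//= mul0r sgr0 mulr0 subrr normr0 mul0r mulr0 invr0 mulr0.
  by rewrite addr_ge0// le_min lexx ltW// sine_bound_gt0.
rewrite (gtr0_sg t0) mulr1 sin_integralE// /sine_error (gtr0_norm t0).
(* If a t >= 1 the rate 2 / (a t) is at most 2; otherwise the integral itself is at most 1. *)
have bound0 a : 0 < a ->
    `|\int[leb]_(s in `]0, a]) (sin (s * t) / s) - pi / 2| <= pi / 2 + 2.
  move=> a0; have := sine_integral_small t (ltW a0); rewrite (gtr0_norm t0) => small.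
  have [at1|at1] := leP 1 (a * t).
    rewrite (le_trans (sine_integral_bound t0 a0))//.
    by rewrite ler_pdivrMr ?mulr_gt0//; nra.
  by rewrite (le_trans (ler_normB _ _))// (ger0_norm (x := pi / 2)) ?divr_ge0 ?ltW//; lra.
have bound a : 0 < a -> `|\int[leb]_(s in `]0, a]) (sin (s * t) / s) - pi / 2| <=
    Order.min sine_bound (2 / (a * t)).
  move=> a0; rewrite le_min (sine_integral_bound t0 a0) andbT /sine_bound.
  by rewrite (le_trans (bound0 _ a0))//; lra.
have -> (u v w : R) : u - v - w = (u - w) - v by ring.
rewrite (le_trans (ler_normB _ _))// addrC lerD//.
  rewrite le_min; apply/andP; split.
    have := bound0 e e0; rewrite ler_norml => /andP[? ?].
    by rewrite /sine_bound ler_norml; apply/andP; split; lra.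
  rewrite (le_trans (sine_integral_small t (ltW e0)))// (gtr0_norm t0) mulrC.
  by rewrite ler_pM2l.
rewrite (le_trans (bound A A0))// le_min ge_min lexx/=.
rewrite ge_min; apply/orP; right.
by rewrite ler_pM2l// lef_pV2 ?posrE ?mulr_gt0// ler_pM2r.
Qed.

(** The common part from e cancels; what remains is an integral between a and b whose integrand is
    at most [1 / min a b] in modulus, whatever t and e are. *)
Lemma cos_integral_error t e a b : 0 < e -> e <= a -> e <= b ->
  `|cos_integral t e a - cos_integral t e b| <= `|b - a| / Order.min a b.
Proof.
move=> e0 ea eb.
wlog ab : a b ea eb / a <= b => [h|].
  have [ab|ba] := orP (le_total a b); first exact: h.
  by rewrite minC distrC (distrC b) h.
have a0 : 0 < a by exact: lt_le_trans ea.
have iab : leb.-integrable `]a, b] (EFin \o (fun s => cos (s * t) / s)).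
  apply: (integrableS _ _ _ (integrable_divr _ (@continuous_cosM R t) a0)) => //.
  exact: subset_itv_oc_cc.
rewrite min_l// distrC /cos_integral Rintegral_itvB//; last first.
  exact: (integrable_divr _ (@continuous_cosM R t) e0).
apply: le_trans; first by apply: le_normr_Rintegral => //.
have ia : leb.-integrable `]a, b] (EFin \o (fun _ : R => a^-1)).
  apply: measurable_bounded_integrable => //=.
  - rewrite lebesgue_measure_itv/=; case: ifPn => // _.
    by rewrite -EFinB ltry.
  - by exists `|a^-1|; split=> // M tM s _ /=; rewrite ltW.
apply: le_trans.
  apply: (le_Rintegral _ _ ia) => //.
    exact: integrable_norm iab.
  move=> s /=; rewrite in_itv/= => /andP[as_ _].
  have s0 : 0 < s by exact: lt_trans as_.
  rewrite normrM normfV (gtr0_norm s0) -[leRHS]mul1r ler_pM ?invr_ge0 ?(ltW s0) ?cos_max//.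
  by rewrite lef_pV2 ?posrE// ltW.
rewrite Rintegral_cst//= lebesgue_measure_itv/= lte_fin mulrC.
case: ifPn => [_|_ /=]; last by rewrite mul0r divr_ge0// ltW.
by rewrite -EFinB/= ger0_norm// subr_ge0.
Qed.

End sine_cosine_integral_bounds.

Lemma bounded_integrable d (T : measurableType d) (R : realType)
    (m : {finite_measure set T -> \bar R}) (f : T -> R) (M : R) : measurable_fun setT f ->
  (forall t, `|f t| <= M) -> m.-integrable setT (EFin \o f).
Proof.
move=> mf fM; apply: measurable_bounded_integrable => //.
  by rewrite ltey_eq fin_num_measure.
exists M; split; first exact: num_real.
by move=> M' MM' t _; exact: le_trans (fM t) (ltW MM').
Qed.

(** * Fubini for the oscillating kernel against a finite measure *)

Section pv_fubini.
Context (R : realType).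
Variables (m : {finite_measure set (measurableTypeR R) -> \bar R}) (x : R).
Variables (p q : R -> R).
Hypotheses (cp : continuous p) (cq : continuous q).
Hypotheses (p1 : forall t, `|p t| <= 1) (q1 : forall t, `|q t| <= 1).

(** Common form of cos (l t) and sin (l t) expanded about x: up to sign, [p t] and [q t] are cos (x
    t) and sin (x t), in one order or the other. *)
Definition osc (l t : R) : R := p t * cos ((l - x) * t) + q t * sin ((l - x) * t).

Definition osc_transform (l : R) : R := \int[m]_t osc l t.

Let norm_osc_le l t : `|osc l t| <= 2.
Proof.
rewrite (le_trans (ler_normD _ _))// (natrD _ 1 1) lerD// normrM.
  by rewrite -[1]mulr1 ler_pM ?cos_max.
by rewrite -[1]mulr1 ler_pM ?sin_max.
Qed.

Let measurable_osc : measurable_fun setT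
  (fun z : measurableTypeR R * measurableTypeR R => osc z.1 z.2).
Proof.
have mc (f g : R -> R) : continuous f -> continuous g -> measurable_fun setT
    (fun z : measurableTypeR R * measurableTypeR R => f z.2 * g ((z.1 - x) * z.2)).
  move=> /continuous_measurable_fun mf /continuous_measurable_fun mg.
  apply: measurable_funM.
    exact: (measurableT_comp mf measurable_snd).
  apply: (measurableT_comp mg); apply: measurable_funM => //.
  exact: measurable_funB.
by apply: measurable_funD; apply: mc => //; [exact: continuous_cos|exact: continuous_sin].
Qed.

Let integrable_osc l : m.-integrable setT (EFin \o osc l).
Proof.
apply: (bounded_integrable m _ (norm_osc_le l)).
exact: (measurableT_comp measurable_osc (measurable_pair1 l)).
Qed.

Section away_from_x.
Variables a b delta : R.
Hypotheses (delta0 : 0 < delta) (abx : forall l, l \in `[a, b] -> delta <= `|l - x|).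

Let f (l t : R) : \bar R := (osc l t / (l - x))%:E.

Let mf : measurable_fun setT
  (fun z : measurableTypeR R * measurableTypeR R => f z.1 z.2).
Proof.
apply/measurable_EFinP; apply: measurable_funM => //.
by apply: (measurableT_comp (@measurable_inv R)); exact: measurable_funB.
Qed.

Let integral_f l : (\int[m]_t f l t = (osc_transform l / (l - x))%:E)%E.
Proof.
rewrite /f /osc_transform -RintegralZr// /Rintegral fineK//.
by apply: integrable_fin_num => //; apply: (fun mT => integrableZr mT _ (integrable_osc l)).
Qed.

(** The integrand is at most 2 / delta away from x, the interval is bounded and m is finite. *)
Let f_lty : (\int[leb]_(l in `[a, b]) \int[m]_(t in setT) `|f l t| < +oo)%E.
Proof.
have mfin : m setT \is a fin_num by exact: fin_num_measure.
apply: (@le_lt_trans _ _ (\int[leb]_(l in `[a, b]) ((2 / delta) * fine (m setT))%:E)%E).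
  apply: ge0_le_integral => //.
  - by move=> l _; exact: integral_ge0.
  - apply: measurable_funTS.
    have mabsf := measurableT_comp (@abse_measurable R setT) mf.
    exact: (measurable_fun_fubini_tonelli_F (m2 := m) _ mabsf (fun=> abse_ge0 _)).
  - move=> l lab; rewrite EFinM fineK//.
    rewrite -integral_cst//; apply: ge0_le_integral => //.
    + apply: measurableT_comp => //.
      exact: (measurableT_comp mf (measurable_pair1 l)).
    + move=> t _; rewrite /f lee_fin normrM ler_pM ?norm_osc_le// normfV lef_pV2 ?posrE//.
        exact: abx.
      by rewrite (lt_le_trans delta0)// abx.
rewrite integral_cst//= lebesgue_measure_itv/=; case: ifPn => _.
  by rewrite -EFinB -EFinM ltry.
by rewrite mule0.
Qed.

Lemma integrable_osc_transform :
  leb.-integrable `[a, b] (EFin \o (fun l => osc_transform l / (l - x))).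
Proof.
have := integrable_fubini_rectangle (m1 := leb) (m2 := m) (D1 := `[a, b]) (f := f)
  (measurable_itv _) measurableT mf f_lty.
by apply: eq_integrable => // l _; rewrite integral_f.
Qed.

Let lebab_lty : (leb (`[a, b]%classic : set R) < +oo)%E.
Proof.
rewrite lebesgue_measure_itv/=; case: ifPn => // _.
by rewrite -EFinB ltry.
Qed.

Let norm_f_le l t : l \in `[a, b] -> `|osc l t / (l - x)| <= 2 / delta.
Proof.
move=> lab; rewrite normrM ler_pM ?norm_osc_le// normfV lef_pV2 ?posrE//; first exact: abx.
by rewrite (lt_le_trans delta0)// abx.
Qed.

Let integrable_f t : leb.-integrable `[a, b] (EFin \o (fun l => osc l t / (l - x))).
Proof.
apply: measurable_bounded_integrable => //=.
- apply: measurable_funTS; have /measurable_EFinP mf' := mf.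
  exact: (measurableT_comp mf' (measurable_pair2 t)).
- exists (2 / delta); split; first exact: num_real.
  by move=> M M2 l /= lab; apply: le_trans (ltW M2); exact: norm_f_le.
Qed.

Let integral_f2 t : (\int[leb]_(l in `[a, b]) f l t =
  (\int[leb]_(l in `[a, b]) (osc l t / (l - x)))%:E)%E.
Proof. by rewrite /Rintegral fineK//; exact: (integrable_fin_num _ (integrable_f t)). Qed.

(** Measurability in t is a by-product of Fubini; no closed formula for the integral is needed. *)
Lemma measurable_kernel : measurable_fun setT
  (fun t => \int[leb]_(l in `[a, b]) (osc l t / (l - x))).
Proof.
apply/measurable_EFinP.
have := measurable_fubini_rectangle2 (m1 := leb) (m2 := m) (D1 := `[a, b]) (f := f)
  (measurable_itv _) measurableT mf f_lty.
by apply: eq_measurable_fun => t _; rewrite integral_f2.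
Qed.

Lemma integrable_kernel : m.-integrable setT
  (EFin \o (fun t => \int[leb]_(l in `[a, b]) (osc l t / (l - x)))).
Proof.
apply: (bounded_integrable m measurable_kernel (M := 2 / delta * fine (leb `[a, b]))) => t.
rewrite -Rintegral_cst//.
apply: le_trans; first by apply: le_normr_Rintegral => //; exact: integrable_f.
apply: le_Rintegral => //.
- exact: integrable_norm (integrable_f t).
- apply: measurable_bounded_integrable => //=; exists (2 / delta).
  split; first exact: num_real.
  by move=> M M2 l _ /=; rewrite ger0_norm ?ltW// divr_gt0.
- by move=> l lab; exact: norm_f_le.
Qed.

Lemma osc_transform_fubini :
  \int[leb]_(l in `[a, b]) (osc_transform l / (l - x)) =
  \int[m]_t \int[leb]_(l in `[a, b]) (osc l t / (l - x)).
Proof.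
rewrite [LHS]/Rintegral; under eq_integral do rewrite -integral_f.
rewrite (fubini_rectangle (m1 := leb) (m2 := m) (D1 := `[a, b]) (f := f)
  (measurable_itv _) measurableT mf f_lty).
by congr fine; apply: eq_integral => t _; rewrite integral_f2.
Qed.

End away_from_x.

End pv_fubini.

Lemma sgr_indicE (R : realType) (t : R) :
  Num.sg t = \1_(`]0, +oo[) t - \1_(`]-oo, 0[) t.
Proof.
rewrite !indicE !mem_setE !in_itv/= andbT.
by case: sgrP => t0; rewrite /= ?subrr ?subr0 ?sub0r.
Qed.

Lemma measurable_sgr (R : realType) : measurable_fun setT (@Num.sg R).
Proof.
rewrite (funext (@sgr_indicE R)).
by apply: measurable_funB; exact: measurable_indic.
Qed.

(** * Passage to the joint limit in e and N *)

Section pv_limit.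
Context (R : realType).
Variables (m : {finite_measure set (measurableTypeR R) -> \bar R}) (x : R).
Variables (p q : R -> R).
Hypotheses (cp : continuous p) (cq : continuous q).
Hypotheses (p1 : forall t, `|p t| <= 1) (q1 : forall t, `|q t| <= 1).

Local Notation osc := (osc x p q).
Local Notation osc_transform := (osc_transform m x p q).

Let left_away e N : forall l, l \in `[- N, x - e] -> e <= `|l - x|.
Proof.
move=> l; rewrite in_itv/= => /andP[_ lx].
by rewrite distrC (le_trans _ (ler_norm _))// lerBrDr addrC -lerBrDr.
Qed.

Let right_away e N : forall l, l \in `[x + e, N] -> e <= `|l - x|.
Proof.
move=> l; rewrite in_itv/= => /andP[lx _].
by rewrite (le_trans _ (ler_norm _))// lerBrDr addrC.
Qed.

Lemma osc_transform_integrable e N : 0 < e ->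
  leb.-integrable `[- N, x - e] (EFin \o (fun l => osc_transform l / (l - x))) /\
  leb.-integrable `[x + e, N] (EFin \o (fun l => osc_transform l / (l - x))).
Proof.
move=> e0; split.
  exact: (integrable_osc_transform m cp cq p1 q1 e0 (@left_away e N)).
exact: (integrable_osc_transform m cp cq p1 q1 e0 (@right_away e N)).
Qed.

Definition pv_kernel (eN : R * R) (t : R) : R :=
  \int[leb]_(l in `[- eN.2, x - eN.1]) (osc l t / (l - x)) +
  \int[leb]_(l in `[x + eN.1, eN.2]) (osc l t / (l - x)).

(* An envelope uniform in e <= 1 / r and N >= r + |x|: dominated convergence,
   available for sequences only, is applied to it along r = n + 1. *)
Definition kernel_error (r t : R) : R := 2 * `|x| / r + 2 * sine_error r t.

(** The cosine term lives between N - x and N + x, at distance [2 * |x|] and both at least r; the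
    two sine integrals, each tending to (pi / 2) sign t, contribute one [sine_error] each. *)
Lemma pv_kernel_error (r t e N : R) : 1 <= r -> 0 < e -> e <= r^-1 -> r + `|x| <= N ->
  `|pv_kernel (e, N) t - pi * q t * Num.sg t| <= kernel_error r t.
Proof.
move=> r1 e0 er rN; have r0 : 0 < r by exact: lt_le_trans r1.
(* Here 1 <= r enters: e <= 1 / r <= r keeps e below both N - x and N + x. *)
have er' : e <= r by rewrite (le_trans er)// (le_trans _ r1)// invf_le1.
have /andP[Nx1 Nx2] : (r <= N - x) && (r <= N + x).
  by have := ler_norm x; have := ler_norm (- x); rewrite normrN => *; apply/andP; split; lra.
have e1 := le_trans er' Nx1; have e2 := le_trans er' Nx2.
rewrite /pv_kernel /= /osc (pv_kernelE (p t) (q t) t e0 e1 e2).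
have C := cos_integral_error t e0 e1 e2.
have S1 := sin_integral_error t r0 e0 er Nx1 e1.
have S2 := sin_integral_error t r0 e0 er Nx2 e2.
have {}C : `|cos_integral t e (N - x) - cos_integral t e (N + x)| <= 2 * `|x| / r.
  apply: le_trans C _; rewrite (_ : N + x - (N - x) = 2 * x); last by ring.
  rewrite normrM ger0_norm// ler_pM ?mulr_ge0 ?invr_ge0 ?le_min//.
    by rewrite !(ltW (lt_le_trans r0 _)).
  by rewrite lef_pV2 ?posrE ?lt_min ?(lt_le_trans r0)// le_min Nx1.
move: C S1 S2; set c := cos_integral _ _ _ - _.
set s1 := sin_integral _ _ _; set s2 := sin_integral _ _ _ => C S1 S2.
rewrite (_ : _ - _ = p t * c +
  q t * ((s1 - pi / 2 * Num.sg t) + (s2 - pi / 2 * Num.sg t))); last by field.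
rewrite /kernel_error (le_trans (ler_normD _ _))// !normrM lerD//.
  by rewrite (le_trans (ler_piMl _ (p1 t)))//.
rewrite (le_trans (ler_piMl _ (q1 t)))// (le_trans (ler_normD _ _))//.
by rewrite mulr_natl mulr2n lerD.
Qed.

Let measurable_sine_error r : measurable_fun setT (@sine_error R r).
Proof.
apply: measurable_funD; apply: measurable_minr => //.
  exact: measurable_funM.
apply: measurable_funM => //; apply: (measurableT_comp (@measurable_inv R)).
exact: measurable_funM.
Qed.

Let kernel_error_ge0 (r t : R) : 0 < r -> 0 <= kernel_error r t.
Proof.
move=> r0; have b0 := @sine_bound_gt0 R.
rewrite addr_ge0 ?divr_ge0 ?mulr_ge0 ?(ltW r0)// addr_ge0// le_min ltW//=.
  by rewrite divr_ge0// ltW.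
by rewrite divr_ge0// mulr_ge0// ltW.
Qed.

Let kernel_error_bound (r t : R) : 1 <= r ->
  kernel_error r t <= 2 * `|x| + 4 * sine_bound R.
Proof.
move=> r1; have r0 : 0 < r by exact: lt_le_trans r1.
rewrite /kernel_error lerD//.
  by rewrite ler_pdivrMr// ler_peMr// mulr_ge0.
rewrite (_ : 4 = 2 * 2); last by ring.
rewrite -mulrA ler_pM2l// /sine_error [leRHS]mulr_natl mulr2n.
by rewrite lerD// ge_min lexx.
Qed.

(** The rate in r has a constant unbounded both near t = 0 and at infinity, so it gives pointwise
    convergence only; [kernel_error_bound] supplies the domination. *)
Let kernel_error_rate (r t : R) : 0 < r ->
  kernel_error r t <= (2 * `|x| + 2 * `|t| + 4 / `|t|) / r.
Proof.
move=> r0.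
rewrite (_ : _ / r = 2 * `|x| / r + 2 * (`|t| / r + 2 / `|t| / r)); last by ring.
rewrite lerD2l ler_pM2l// lerD//; first by rewrite ge_min lexx orbT.
rewrite ge_min (_ : 2 / (r * `|t|) = 2 / `|t| / r) ?lexx ?orbT//.
by rewrite invfM; ring.
Qed.

Lemma integrable_kernel_error (r : R) : 1 <= r ->
  m.-integrable setT (EFin \o kernel_error r).
Proof.
move=> r1; apply: (bounded_integrable m (M := 2 * `|x| + 4 * sine_bound R)).
  apply: measurable_funD => //; apply: measurable_funM => //.
  exact: measurable_sine_error.
move=> t; rewrite ger0_norm ?kernel_error_bound// kernel_error_ge0//.
exact: lt_le_trans r1.
Qed.

Lemma integral_kernel_error_cvg :
  \int[m]_t kernel_error n.+1%:R t @[n --> \oo] --> (0 : R).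
Proof.
pose M := 2 * `|x| + 4 * sine_bound R.
have r0 n : 0 < n.+1%:R :> R by rewrite ltr0n.
have r1 n : 1 <= n.+1%:R :> R by rewrite ler1n.
have cvg_pt t : kernel_error n.+1%:R t @[n --> \oo] --> (0 : R).
  apply: (@squeeze_cvgr _ _ _ _ (fun=> 0)
    (fun n => (2 * `|x| + 2 * `|t| + 4 / `|t|) * n.+1%:R^-1)).
  - by apply: nearW => n; rewrite kernel_error_ge0//= kernel_error_rate.
  - exact: cvg_cst.
  - rewrite -[X in _ --> X](mulr0 (2 * `|x| + 2 * `|t| + 4 / `|t|)).
    by apply: cvgM; [exact: cvg_cst|exact: cvg_harmonic].
(* A constant may dominate because m is finite. *)
have iM : m.-integrable setT (EFin \o (fun _ : R => M)).
  by apply: (bounded_integrable m (M := `|M|)).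
have : (\int[m]_t (kernel_error n.+1%:R t)%:E @[n --> \oo] --> \int[m]_(t in setT) 0)%E.
  apply: (dominated_cvg measurableT _ _ _ iM) => //.
  - by move=> n; have /integrableP[] := integrable_kernel_error (r1 n).
  - move=> t _; apply: cvg_EFin; first exact: nearW.
    exact: cvg_pt.
  - by move=> n t _; rewrite lee_fin ger0_norm ?kernel_error_ge0// kernel_error_bound.
rewrite integral0 => h; exact: (fine_cvg h).
Qed.

Lemma osc_transform_pv_cvg :
  (fun eN : R * R =>
     \int[leb]_(l in `[- eN.2, x - eN.1]) (osc_transform l / (l - x)) +
     \int[leb]_(l in `[x + eN.1, eN.2]) (osc_transform l / (l - x)))
  @ @pv_filter R --> \int[m]_t (pi * q t * Num.sg t).
Proof.
apply/cvgrPdist_le => d d0.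
have /cvgrPdist_le/(_ d d0)[n _ /(_ n (leqnn n)) /=] := integral_kernel_error_cvg.
rewrite sub0r normrN => nd.
have r0 : 0 < n.+1%:R :> R by rewrite ltr0n.
have r1 : 1 <= n.+1%:R :> R by rewrite ler1n.
(* One n from the sequential limit fixes both thresholds, and the envelope then covers every pair
   (e, N) beyond them at once. *)
exists ([set e | 0 < e /\ e <= n.+1%:R^-1], [set N | n.+1%:R + `|x| <= N]).
  split => /=.
    near=> e; split => //.
    by near: e; apply: nbhs_right_le; rewrite invr_gt0.
  by apply: nbhs_pinfty_ge; exact: num_real.
move=> [e N] /= [[e0 er] rN].
have [iL iR] := osc_transform_integrable N e0.
have ikL := integrable_kernel m cp cq p1 q1 e0 (@left_away e N).
have ikR := integrable_kernel m cp cq p1 q1 e0 (@right_away e N).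
have iker : m.-integrable setT (EFin \o pv_kernel (e, N)) by exact: integrableD ikL ikR.
have ilim : m.-integrable setT (EFin \o (fun t => pi * q t * Num.sg t)).
  apply: (bounded_integrable m (M := pi)).
    apply: measurable_funM; last exact: measurable_sgr.
    by apply: measurable_funM => //; exact: continuous_measurable_fun.
  move=> t; rewrite !normrM (ger0_norm (pi_ge0 _)) -mulrA ler_piMr ?pi_ge0//.
  by rewrite mulr_ile1 ?q1// normr_sg lern1 leq_b1.
rewrite (osc_transform_fubini m cp cq p1 q1 e0 (@left_away e N)).
rewrite (osc_transform_fubini m cp cq p1 q1 e0 (@right_away e N)).
have idiff : m.-integrable setT
    (EFin \o (fun t => pv_kernel (e, N) t - pi * q t * Num.sg t)).
  by apply: (fun mT => integrableB mT iker ilim).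
rewrite -RintegralD// distrC -RintegralB//.
apply: le_trans; first exact: (le_normr_Rintegral _ idiff).
apply: le_trans nd; apply: le_trans (ler_norm _); apply: le_Rintegral => //.
- exact: integrable_norm idiff.
- exact: integrable_kernel_error.
- by move=> t _; exact: pv_kernel_error.
Unshelve. all: by end_near.
Qed.

End pv_limit.

(** * Linearity of the componentwise complex integral *)

Section complex_integral_linear.
Context d (T : measurableType d) (R : realType).
Variables (m : {measure set T -> \bar R}) (D : set T) (mD : measurable D).
Implicit Types (f g : T -> R[i]) (c : R[i]).

Lemma complex_ReD (a b : R[i]) : complex.Re (a + b) = complex.Re a + complex.Re b.
Proof. by case: a b => ? ? []. Qed.
Lemma complex_ImD (a b : R[i]) : complex.Im (a + b) = complex.Im a + complex.Im b.
Proof. by case: a b => ? ? []. Qed.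
Lemma complex_ReM (a b : R[i]) : complex.Re (a * b) =
  complex.Re a * complex.Re b - complex.Im a * complex.Im b.
Proof. by case: a b => ? ? []. Qed.
Lemma complex_ImM (a b : R[i]) : complex.Im (a * b) =
  complex.Re a * complex.Im b + complex.Im a * complex.Re b.
Proof. by case: a b => ? ? []. Qed.

Let integrable_lin (u v : T -> R) (a b : R) :
  m.-integrable D (EFin \o u) -> m.-integrable D (EFin \o v) ->
  m.-integrable D (EFin \o (fun t => a * u t + b * v t)).
Proof.
move=> iu iv.
exact: (integrableD mD (integrableZl mD a iu) (integrableZl mD b iv)).
Qed.

Let Rintegral_lin (u v : T -> R) (a b : R) :
  m.-integrable D (EFin \o u) -> m.-integrable D (EFin \o v) ->
  \int[m]_(t in D) (a * u t + b * v t) =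
  a * \int[m]_(t in D) u t + b * \int[m]_(t in D) v t.
Proof.
move=> iu iv; rewrite (RintegralD mD (integrableZl mD a iu) (integrableZl mD b iv)).
by rewrite !RintegralZl.
Qed.

Lemma complex_integrableD f g : complex_integrable m D f ->
  complex_integrable m D g -> complex_integrable m D (fun t => f t + g t).
Proof.
move=> [fr fi] [gr gi]; split.
- under eq_fun do rewrite complex_ReD; exact: (integrableD mD fr gr).
- under eq_fun do rewrite complex_ImD; exact: (integrableD mD fi gi).
Qed.

Lemma complex_integrableZ c f : complex_integrable m D f ->
  complex_integrable m D (fun t => c * f t).
Proof.
move=> [fr fi]; split.
- by under eq_fun do rewrite complex_ReM -mulNr; exact: integrable_lin.
- by under eq_fun do rewrite complex_ImM; exact: integrable_lin.
Qed.

Lemma complex_integralD f g : complex_integrable m D f ->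
  complex_integrable m D g -> complex_integral m D (fun t => f t + g t) =
  complex_integral m D f + complex_integral m D g.
Proof.
move=> [fr fi] [gr gi]; rewrite /complex_integral.
under eq_Rintegral do rewrite complex_ReD.
under [X in _ +i* X]eq_Rintegral do rewrite complex_ImD.
by rewrite !RintegralD.
Qed.

Lemma complex_integralZ c f : complex_integrable m D f ->
  complex_integral m D (fun t => c * f t) = c * complex_integral m D f.
Proof.
move=> [fr fi]; rewrite /complex_integral.
under eq_Rintegral do rewrite complex_ReM -mulNr.
under [X in _ +i* X]eq_Rintegral do rewrite complex_ImM.
rewrite !Rintegral_lin//; apply/eqP; rewrite eq_complex complex_ReM complex_ImM /=.
by rewrite mulNr !eqxx.
Qed.

Lemma complex_integrable_real (u : T -> R) : m.-integrable D (EFin \o u) ->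
  complex_integrable m D (fun t => (u t)%:C).
Proof. by move=> iu; split => //=; exact: integrable0. Qed.

Lemma complex_integral_real (u : T -> R) :
  complex_integral m D (fun t => (u t)%:C) = (\int[m]_(t in D) u t)%:C.
Proof. by rewrite /complex_integral /= /Rintegral integral0. Qed.

End complex_integral_linear.

Lemma cvg_real_complex (R : realType) T (F : set_system T) (FF : Filter F)
    (f : T -> R) (l : R) :
  f @ F --> l -> (fun t => (f t)%:C : Cplx R) @ F --> (l%:C : Cplx R).
Proof.
move=> /cvgrPdist_lt fl; apply/cvgrPdist_lt => e /complexP_lt[e0 ->].
apply: filterS (fl _ e0) => t; rewrite -ltcR -rmorphB/= => fle.
by rewrite normc_def/= expr0n addr0 sqrtr_sqr.
Qed.

(* These two are stated over an abstract K because unification of topologies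
   diverges when the library lemmas are applied directly over Cplx R. *)
Lemma numField_cvgP (K : numFieldType) T (F : set_system T) (f : T -> K) (l : K) :
  f @ F --> l -> cvg (f @ F).
Proof. exact: cvgP. Qed.

Lemma numField_cvg_lim (K : numFieldType) T (F : set_system T) (FF : ProperFilter F)
  (f : T -> K) (l : K) : f @ F --> l -> lim (f @ F) = l.
Proof. by apply: cvg_lim; exact: norm_hausdorff. Qed.

(** * Linearity of the principal value *)

Section has_pv.
Context (R : realType).
Variable x : R.
Implicit Types (f g : R -> R[i]) (K L c : R[i]).

(** Existence and value are carried together, since the integral and [lim] are linear only where
    they exist. *)
Definition has_pv f L : Prop :=
  (forall e N : R, 0 < e ->
     complex_integrable leb `[- N, x - e] (Cauchy_integrand f x) /\
     complex_integrable leb `[x + e, N] (Cauchy_integrand f x)) /\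
  pv_trunc f x @ @pv_filter R --> (L : Cplx R).

Lemma pv_filterP : ProperFilter (@pv_filter R).
Proof. exact: filter_prod_proper. Qed.

Lemma has_pv_exists f L : has_pv f L -> pv_exists f x.
Proof.
move=> [fi fL]; split; first exact: fi.
exact: (@numField_cvgP (Cplx R) _ _ _ L fL).
Qed.

Lemma has_pv_integral f L : has_pv f L -> pv_integral f x = L.
Proof.
move=> [_ fL]; have ? := pv_filterP.
exact: (@numField_cvg_lim (Cplx R) _ _ _ _ L fL).
Qed.

(** Integrability, hence linearity of the truncated integrals, is known for positive e only; this
    suffices along the filter. *)
Let pos_near (P : R * R -> Prop) : (forall eN, 0 < eN.1 -> P eN) ->
  \forall eN \near @pv_filter R, P eN.
Proof.
move=> h; exists ([set e | 0 < e], setT) => /=; last by move=> eN [/= ? _]; exact: h.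
by split; [exact: nbhs_right_gt|exact: filterT].
Qed.

Lemma has_pvD f g K L : has_pv f K -> has_pv g L ->
  has_pv (fun l => f l + g l) (K + L).
Proof.
move=> [fi fK] [gi gL].
have E : Cauchy_integrand (fun l => f l + g l) x =
    (fun l => Cauchy_integrand f x l + Cauchy_integrand g x l).
  by apply/funext => l; rewrite /Cauchy_integrand mulrDl.
have ? := pv_filterP.
split.
  move=> e N e0; have [f1 f2] := fi e N e0; have [g1 g2] := gi e N e0.
  by rewrite E; split; apply: complex_integrableD.
apply: cvg_trans (cvgD fK gL); apply: near_eq_cvg; apply: pos_near => -[e N] /= e0.
have [f1 f2] := fi e N e0; have [g1 g2] := gi e N e0.
by rewrite /pv_trunc /= E !complex_integralD// addrACA.
Qed.

Lemma has_pvZ f L c : has_pv f L -> has_pv (fun l => c * f l) (c * L).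
Proof.
move=> [fi fL].
have E : Cauchy_integrand (fun l => c * f l) x = (fun l => c * Cauchy_integrand f x l).
  by apply/funext => l; rewrite /Cauchy_integrand mulrA.
have ? := pv_filterP.
split.
  move=> e N e0; have [f1 f2] := fi e N e0.
  by rewrite E; split; apply: complex_integrableZ.
have cc : (fun _ : R * R => c : Cplx R) @ @pv_filter R --> (c : Cplx R) by exact: cvg_cst.
apply: cvg_trans (cvgM cc fL); apply: near_eq_cvg; apply: pos_near => -[e N] /= e0.
have [f1 f2] := fi e N e0.
by rewrite /pv_trunc /= E !complex_integralZ// mulrDr.
Qed.

Lemma has_pv_real (u : R -> R) (L : R) :
  (forall e N, 0 < e ->
     leb.-integrable `[- N, x - e] (EFin \o (fun l => u l / (l - x))) /\
     leb.-integrable `[x + e, N] (EFin \o (fun l => u l / (l - x)))) ->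
  (fun eN : R * R =>
     \int[leb]_(l in `[- eN.2, x - eN.1]) (u l / (l - x)) +
     \int[leb]_(l in `[x + eN.1, eN.2]) (u l / (l - x)))
    @ @pv_filter R --> L ->
  has_pv (fun l => (u l)%:C) L%:C.
Proof.
move=> iu uL.
have E : Cauchy_integrand (fun l => (u l)%:C) x = (fun l => (u l / (l - x))%:C).
  by apply/funext => l; rewrite /Cauchy_integrand rmorphM/= fmorphV.
split.
  move=> e N e0; have [u1 u2] := iu e N e0.
  by rewrite E; split; exact: complex_integrable_real.
have ? := pv_filterP.
apply: cvg_trans (cvg_real_complex _ uL); apply: near_eq_cvg; apply: pos_near => -[e N] /= e0.
by rewrite /pv_trunc /= E !complex_integral_real rmorphD.
Qed.

End has_pv.

(** * The theorem for one finite positive measure, before normalisation *)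

Section fourier_finite_measure.
Context (R : realType).
Variables (m : {finite_measure set (measurableTypeR R) -> \bar R}) (x : R).

Let ccos : continuous (fun t : R => cos (x * t)).
Proof. by move=> t; apply/differentiable_continuous/derivable1_diffP/ex_derive. Qed.

Let csin : continuous (fun t : R => sin (x * t)).
Proof. by move=> t; apply/differentiable_continuous/derivable1_diffP/ex_derive. Qed.

Let cNsin : continuous (fun t : R => - sin (x * t)).
Proof. by move=> t; apply: cvgN; exact: csin. Qed.

Let Nsin1 t : `|- sin (x * t)| <= 1. Proof. by rewrite normrN sin_max. Qed.

Let cosE (l t : R) :
  cos (l * t) = osc x (fun t => cos (x * t)) (fun t => - sin (x * t)) l t.
Proof.
by rewrite /osc mulNr (mulrC (cos (x * t))) (mulrC (sin (x * t))) -cosD -mulrDl subrK.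
Qed.

Let sinE (l t : R) :
  sin (l * t) = osc x (fun t => sin (x * t)) (fun t => cos (x * t)) l t.
Proof.
rewrite /osc (addrC (sin (x * t) * _)) (mulrC (cos (x * t))).
by rewrite (mulrC (sin (x * t))) -sinD -mulrDl subrK.
Qed.

Lemma has_pv_cos : has_pv x (fun l => (\int[m]_t cos (l * t))%:C)
  (\int[m]_t (pi * - sin (x * t) * Num.sg t))%:C.
Proof.
have -> : (fun l : R => (\int[m]_t cos (l * t))%:C) =
    (fun l => (osc_transform m x (fun t => cos (x * t)) (fun t => - sin (x * t)) l)%:C).
  by apply/funext => l; congr _%:C; apply: eq_Rintegral => t _; rewrite cosE.
apply: has_pv_real.
  move=> e N e0; apply: osc_transform_integrable => // t; exact: cos_max.
apply: osc_transform_pv_cvg => // t; exact: cos_max.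
Qed.

Lemma has_pv_sin : has_pv x (fun l => (\int[m]_t sin (l * t))%:C)
  (\int[m]_t (pi * cos (x * t) * Num.sg t))%:C.
Proof.
have -> : (fun l : R => (\int[m]_t sin (l * t))%:C) =
    (fun l => (osc_transform m x (fun t => sin (x * t)) (fun t => cos (x * t)) l)%:C).
  by apply/funext => l; congr _%:C; apply: eq_Rintegral => t _; rewrite sinE.
apply: has_pv_real.
  by move=> e N e0; apply: osc_transform_integrable => // t; [exact: sin_max|exact: cos_max].
by apply: osc_transform_pv_cvg => // t; [exact: sin_max|exact: cos_max].
Qed.

(** Only the coefficients [q] survive: the cosine yields - sin (x t), and -i times the sine yields
    -i cos (x t). Their sum is -i exp(-i x t). *)
Lemma has_pv_expi :
  has_pv x (fun l => complex_integral m setT (fun t => expi (- (l * t))))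
  (- 'i%C * pi%:C *
    complex_integral m setT (fun t => (Num.sg t)%:C * expi (- (x * t)))).
Proof.
have -> : (fun l => complex_integral m setT (fun t => expi (- (l * t)))) =
    (fun l => (\int[m]_t cos (l * t))%:C + - 'i%C * (\int[m]_t sin (l * t))%:C).
  apply/funext => l; rewrite /complex_integral /=.
  under eq_Rintegral do rewrite cosN.
  under [X in _ +i* X]eq_Rintegral do rewrite sinN -mulN1r.
  rewrite RintegralZl//; last first.
    apply: (bounded_integrable m (M := 1)); last by move=> t; exact: sin_max.
    apply: continuous_measurable_fun => t.
    exact/differentiable_continuous/derivable1_diffP/ex_derive.
  by rewrite mulN1r; apply/eqP; rewrite eq_complex /=; apply/andP; split; apply/eqP; ring.
have := has_pvD has_pv_cos (has_pvZ (- 'i%C) has_pv_sin).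
rewrite (_ : _ + _ = - 'i%C * pi%:C *
    complex_integral m setT (fun t => (Num.sg t)%:C * expi (- (x * t))))//.
have isin : m.-integrable setT (EFin \o (fun t => sin (x * t) * Num.sg t)).
  apply: (bounded_integrable m (M := 1)).
    apply: measurable_funM; last exact: measurable_sgr.
    by apply: continuous_measurable_fun; exact: csin.
  by move=> t; rewrite normrM mulr_ile1 ?sin_max// normr_sg lern1 leq_b1.
have icos : m.-integrable setT (EFin \o (fun t => cos (x * t) * Num.sg t)).
  apply: (bounded_integrable m (M := 1)).
    apply: measurable_funM; last exact: measurable_sgr.
    by apply: continuous_measurable_fun; exact: ccos.
  by move=> t; rewrite normrM mulr_ile1 ?cos_max// normr_sg lern1 leq_b1.
rewrite /complex_integral.
have -> : \int[m]_t (pi * - sin (x * t) * Num.sg t) =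
    - pi * \int[m]_t (sin (x * t) * Num.sg t).
  by rewrite -RintegralZl//; apply: eq_Rintegral => t _; ring.
have -> : \int[m]_t (pi * cos (x * t) * Num.sg t) = pi * \int[m]_t (cos (x * t) * Num.sg t).
  by rewrite -RintegralZl//; apply: eq_Rintegral => t _; ring.
have -> : \int[m]_t complex.Re ((Num.sg t)%:C * expi (- (x * t))) =
    \int[m]_t (cos (x * t) * Num.sg t).
  by apply: eq_Rintegral => t _; rewrite complex_ReM /= cosN; ring.
have -> : \int[m]_t complex.Im ((Num.sg t)%:C * expi (- (x * t))) =
    - \int[m]_t (sin (x * t) * Num.sg t).
  rewrite -[RHS]mulN1r -RintegralZl//.
  by apply: eq_Rintegral => t _; rewrite complex_ImM /= sinN; ring.
by apply/eqP; rewrite eq_complex /=; apply/andP; split; apply/eqP; ring.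
Qed.

End fourier_finite_measure.

(** * Integration against restrictions and sums of measures *)

Section jordan_parts.
Context d (T : measurableType d) (R : realType).

(** The two measures agree on subsets of D, and the complement of D is null for the restricted
    one. *)
Lemma integral_mrestr (m : {measure set T -> \bar R}) (D : set T)
    (mD : measurable D) (g : T -> \bar R) : measurable_fun setT g ->
  (\int[mrestr m mD]_t g t = \int[m]_(t in D) g t)%E.
Proof.
move=> mg; have mDC : measurable (~` D) by exact: measurableC.
rewrite -{1}(setUv D) integral_setU//; last 2 first.
- by rewrite setUv.
- by apply/disj_set2P; rewrite setICr.
rewrite [X in (_ + X)%E]null_set_integral//; last 2 first.
- exact: measurable_funTS.
- by rewrite /= /mrestr setICl measure0.
rewrite adde0; apply: eq_measure_integral => A mA AD.
by rewrite /= /mrestr setIidl.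
Qed.

Lemma integrable_mrestr (m : {measure set T -> \bar R}) (D : set T)
    (mD : measurable D) (g : T -> \bar R) :
  m.-integrable setT g -> (mrestr m mD).-integrable setT g.
Proof.
move=> /integrableP[mg gm]; apply/integrableP; split => //.
rewrite integral_mrestr; last exact: measurableT_comp.
apply: le_lt_trans gm; apply: ge0_subset_integral => //.
exact: measurableT_comp.
Qed.

Lemma integrable_measure_add (m1 m2 : {measure set T -> \bar R}) (g : T -> \bar R) :
  m1.-integrable setT g -> m2.-integrable setT g ->
  (measure_add m1 m2).-integrable setT g.
Proof.
move=> /integrableP[mg g1] /integrableP[_ g2]; apply/integrableP; split => //.
rewrite ge0_integral_measure_add//; last exact: measurableT_comp.
exact: lte_add_pinfty.
Qed.

End jordan_parts.

(** * Integration against a signed measure with density sign *)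

Section sgn_measure.
Context (R : realType).
Notation TR := (measurableTypeR R).
Notation pos_half := (`]0, +oo[%classic : set TR).
Notation neg_half := (`]-oo, 0[%classic : set TR).

Lemma Rintegral_sgr (m : {finite_measure set TR -> \bar R}) (A : set TR) :
  measurable A -> ((\int[m]_(t in A) Num.sg (t : R))%:E =
    m (A `&` pos_half) - m (A `&` neg_half))%E.
Proof.
move=> mA; under eq_Rintegral do rewrite sgr_indicE.
have i1 (D : set TR) : measurable D -> m.-integrable A (EFin \o \1_D).
  move=> mD; apply: measurable_bounded_integrable => //.
    by rewrite ltey_eq fin_num_measure.
  exists 1; split => // M M1 t _ /=; rewrite (le_trans _ (ltW M1))// indicE.
  by case: (_ \in _); rewrite ?normr1 ?normr0.
rewrite RintegralB//; [|exact: i1|exact: i1].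
rewrite /Rintegral !integral_indic// EFinB !fineK ?fin_num_measure//.
- by rewrite setIC (setIC neg_half).
- exact: measurableI.
- exact: measurableI.
Qed.

Lemma Rintegral_sgrM (m : {finite_measure set TR -> \bar R}) (g : R -> R) :
  m.-integrable setT (EFin \o g) -> \int[m]_t (Num.sg t * g t) =
  \int[m]_(t in pos_half) g t - \int[m]_(t in neg_half) g t.
Proof.
move=> ig.
rewrite (Rintegral_mkcond _ pos_half) (Rintegral_mkcond _ neg_half) -RintegralB//.
- apply: eq_Rintegral => t _; rewrite sgr_indicE !patchE !indicE mulrBl.
  by congr (_ - _); case: (t \in _); rewrite ?mul1r ?mul0r.
- rewrite -restrict_EFin; apply/integrable_restrict => //=.
  by rewrite setTI; apply: integrableS ig.
- rewrite -restrict_EFin; apply/integrable_restrict => //=.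
  by rewrite setTI; apply: integrableS ig.
Qed.

Let eqD_of_eqB (u v w z : \bar R) : u \is a fin_num -> v \is a fin_num ->
  w \is a fin_num -> z \is a fin_num -> (u - v = w - z -> u + z = v + w)%E.
Proof.
case: u v w z => [u| |] [v| |] [w| |] [z| |]//= _ _ _ _ [] e.
by rewrite -!EFinD; congr EFin; lra.
Qed.

(* Moving the negative parts across turns the equality of signed measures into
   one of positive measures, for which the integral is additive. *)
Lemma charge_integral_sgr (nu : {charge set TR -> \bar R})
    (a b : {finite_measure set TR -> \bar R}) (g : R -> R) (M : R) :
  measurable_fun setT g -> (forall t, `|g t| <= M) ->
  (forall A, measurable A ->
    nu A = (\int[a]_(t in A) Num.sg (t : R) - \int[b]_(t in A) Num.sg (t : R))%:E) ->
  \int[charge_pos nu]_t g t - \int[charge_neg nu]_t g t =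
  \int[a]_t (Num.sg t * g t) - \int[b]_t (Num.sg t * g t).
Proof.
move=> mg gM nuE.
have ig (m : {finite_measure set TR -> \bar R}) : m.-integrable setT (EFin \o g).
  exact: (bounded_integrable m mg gM).
have mP : measurable pos_half by [].
have mN : measurable neg_half by [].
(* With P and N for the positive and negative half-lines, nu+ - nu- = (a|P - a|N) - (b|P - b|N) is
   rearranged so that only sums occur. *)
pose m1 := measure_add (charge_pos nu) (measure_add (mrestr a mN) (mrestr b mP)).
pose m2 := measure_add (charge_neg nu) (measure_add (mrestr a mP) (mrestr b mN)).
have addE (m c e : {measure set TR -> \bar R}) A :
    (measure_add m (measure_add c e) A = m A + (c A + e A))%E.
  by rewrite measure_addE; congr (_ + _)%E; exact: measure_addE.
have m12 A : measurable A -> m1 A = m2 A.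
  move=> mA; rewrite /m1 /m2 !addE.
  change ((charge_pos nu A + (a (A `&` neg_half) + b (A `&` pos_half)))%E =
    (charge_neg nu A + (a (A `&` pos_half) + b (A `&` neg_half)))%E).
  have fin (m : {finite_measure set TR -> \bar R}) (D : set TR) :
      measurable D -> m (A `&` D) \is a fin_num.
    by move=> mD; apply: fin_num_measure; exact: measurableI.
  apply: eqD_of_eqB; rewrite ?fin_num_measure// ?fin_numD ?fin//.
  have <- : nu A = (charge_pos nu A - charge_neg nu A)%E.
    by rewrite (jordan_decomp (Hahn_posneg nu) mA) /cadd /= cscaleN1.
  rewrite nuE// EFinB !Rintegral_sgr//.
  move: (fin a _ mP) (fin a _ mN) (fin b _ mP) (fin b _ mN).
  case: (a _) => [?| |]//; case: (a _) => [?| |]//.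
  case: (b _) => [?| |]//; case: (b _) => [?| |]// _ _ _ _.
  by rewrite -?EFinD -?EFinB -?EFinD -?EFinB; congr EFin; ring.
have ir (m : {finite_measure set TR -> \bar R}) (D : set TR) (mD : measurable D) :
    (mrestr m mD).-integrable setT (EFin \o g).
  by apply: integrable_mrestr; exact: ig.
have int_add (m : {finite_measure set TR -> \bar R})
    (c e : {finite_measure set TR -> \bar R}) (C E : set TR)
    (mC : measurable C) (mE : measurable E) :
    (\int[measure_add m (measure_add (mrestr c mC) (mrestr e mE))]_t (g t)%:E =
     (\int[m]_t g t + (\int[c]_(t in C) g t + \int[e]_(t in E) g t))%:E)%E.
  have iadd : (measure_add (mrestr c mC) (mrestr e mE)).-integrable setT (EFin \o g).
    by apply: integrable_measure_add; exact: ir.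
  have mEg : measurable_fun setT (EFin \o g) by exact/measurable_EFinP.
  rewrite (integral_measure_add measurableT (ig m) iadd).
  rewrite (integral_measure_add measurableT (ir c _ mC) (ir e _ mE)).
  rewrite (integral_mrestr c mC mEg) (integral_mrestr e mE mEg).
  have fin (n : {finite_measure set TR -> \bar R}) (D : set TR) : measurable D ->
      (\int[n]_(t in D) (EFin \o g) t)%E \is a fin_num.
    by move=> mD; apply: integrable_fin_num => //; apply: integrableS (ig n).
  by rewrite /Rintegral !EFinD !fineK ?fin.
have := eq_measure_integral m2 (m1 := m1) (D := setT) (f := EFin \o g)
  (fun A mA _ => m12 A mA).
rewrite /m1 /m2 !int_add => -[] H.
rewrite !Rintegral_sgrM//; lra.
Qed.

End sgn_measure.

(** * The Fourier transform of nu and the assembly of the Jordan parts *)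

Section sgn_charge_fourier.
Context (R : realType).
Notation TR := (measurableTypeR R).
Variable mu : {charge set TR -> \bar R[i]}.

Let sgn_measurable_integral (nu : {charge set TR -> \bar R}) (A : set TR) :
  charge_integral nu A (fun t : R => (Num.sg t)%:C) =
  (\int[charge_pos nu]_(t in A) Num.sg (t : R) -
   \int[charge_neg nu]_(t in A) Num.sg (t : R))%:C.
Proof. by rewrite /charge_integral !complex_integral_real -rmorphB. Qed.

(** Because sign is real-valued, the real part of nu involves the real part of mu alone, and
    likewise for the imaginary parts. *)
Let Re_sgn_chargeE A : Re_charge (sgn_charge mu) A =
  (\int[charge_pos (Re_charge mu)]_(t in A) Num.sg (t : R) -
   \int[charge_neg (Re_charge mu)]_(t in A) Num.sg (t : R))%:E.
Proof.
rewrite -[LHS]/((complex.Re (complex_charge_integral mu A (fun t : R => (Num.sg t)%:C)))%:E).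
rewrite /complex_charge_integral !sgn_measurable_integral.
by congr EFin; rewrite /=; ring.
Qed.

Let Im_sgn_chargeE A : Im_charge (sgn_charge mu) A =
  (\int[charge_pos (Im_charge mu)]_(t in A) Num.sg (t : R) -
   \int[charge_neg (Im_charge mu)]_(t in A) Num.sg (t : R))%:E.
Proof.
rewrite -[LHS]/((complex.Im (complex_charge_integral mu A (fun t : R => (Num.sg t)%:C)))%:E).
rewrite /complex_charge_integral !sgn_measurable_integral.
by congr EFin; rewrite /=; ring.
Qed.

(** [nu'] enters only through its values on measurable sets, so its choice of Hahn decomposition is
    harmless; cosine and sine are treated separately as bounded real integrands. *)
Let charge_integral_expi_sgr (nu nu' : {charge set TR -> \bar R}) (x : R) :
  (forall A, measurable A ->
    nu' A = (\int[charge_pos nu]_(t in A) Num.sg (t : R) -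
             \int[charge_neg nu]_(t in A) Num.sg (t : R))%:E) ->
  charge_integral nu' setT (fun t : R => expi (- (x * t))) =
  charge_integral nu setT (fun t : R => (Num.sg t)%:C * expi (- (x * t))).
Proof.
move=> nuE.
have mcos : measurable_fun setT (fun t : R => cos (- (x * t))).
  apply: continuous_measurable_fun => s.
  exact/differentiable_continuous/derivable1_diffP/ex_derive.
have msin : measurable_fun setT (fun t : R => sin (- (x * t))).
  apply: continuous_measurable_fun => s.
  exact/differentiable_continuous/derivable1_diffP/ex_derive.
have Re_eq := charge_integral_sgr mcos (fun t => cos_max _) nuE.
have Im_eq := charge_integral_sgr msin (fun t => sin_max _) nuE.
rewrite /charge_integral /complex_integral.
have reE (m : {measure set TR -> \bar R}) :
    \int[m]_t complex.Re ((Num.sg (t : R))%:C * expi (- (x * t))) =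
    \int[m]_t (Num.sg (t : R) * cos (- (x * t))).
  by apply: eq_Rintegral => t _; rewrite complex_ReM /=; ring.
have imE (m : {measure set TR -> \bar R}) :
    \int[m]_t complex.Im ((Num.sg (t : R))%:C * expi (- (x * t))) =
    \int[m]_t (Num.sg (t : R) * sin (- (x * t))).
  by apply: eq_Rintegral => t _; rewrite complex_ImM /=; ring.
by rewrite !reE !imE; apply/eqP; rewrite eq_complex /= Re_eq Im_eq !eqxx.
Qed.

Lemma Fourier_sgn_charge (x : R) :
  Fourier (sgn_charge mu) x = ((Num.sqrt (2 * pi))^-1)%:C *
    complex_charge_integral mu setT (fun t : R => (Num.sg t)%:C * expi (- (x * t))).
Proof.
rewrite /Fourier /complex_charge_integral.
by congr (_ * (_ + _ * _)); apply: charge_integral_expi_sgr => A _;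
  [exact: Re_sgn_chargeE|exact: Im_sgn_chargeE].
Qed.

Lemma has_pv_Fourier (x : R) :
  has_pv x (Fourier mu) (- 'i%C * pi%:C * Fourier (sgn_charge mu) x).
Proof.
rewrite Fourier_sgn_charge.
have has_pv_charge (nu : {charge set TR -> \bar R}) :
    has_pv x (fun l => charge_integral nu setT (fun t : R => expi (- (l * t))))
      (- 'i%C * pi%:C *
       charge_integral nu setT (fun t : R => (Num.sg t)%:C * expi (- (x * t)))).
  have := has_pvD (has_pv_expi (charge_pos nu) x)
                  (has_pvZ (-1) (has_pv_expi (charge_neg nu) x)).
  rewrite (_ : _ + _ = - 'i%C * pi%:C *
    charge_integral nu setT (fun t : R => (Num.sg t)%:C * expi (- (x * t)))); last first.
    by rewrite /charge_integral; ring.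
  by rewrite /charge_integral; under eq_fun do rewrite mulN1r.
have := has_pvZ (((Num.sqrt (2 * pi))^-1)%:C)
  (has_pvD (has_pv_charge (Re_charge mu))
           (has_pvZ 'i%C (has_pv_charge (Im_charge mu)))).
by rewrite (_ : _ * (_ + _) = - 'i%C * pi%:C * (((Num.sqrt (2 * pi))^-1)%:C *
    complex_charge_integral mu setT (fun t : R => (Num.sg t)%:C * expi (- (x * t)))));
  last by rewrite /complex_charge_integral; ring.
Qed.

End sgn_charge_fourier.

Unset Implicit Arguments.

Theorem mainTheorem6 (R : realType)
    (mu : {charge set (measurableTypeR R) -> \bar R[i]}) (x : R) :
  pv_exists (Fourier mu) x /\
  (pi^-1)%:C * pv_integral (Fourier mu) x = - 'i%C * Fourier (sgn_charge mu) x.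
Proof.
have H := has_pv_Fourier mu x; split; first exact: has_pv_exists H.
rewrite (has_pv_integral H) -mulrA mulrCA; congr (_ * _).
by rewrite mulrA -rmorphM/= mulVf ?mul1r// gt_eqF// pi_gt0.
Qed.
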